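(* Let $K$ be a field, let $G$ be a finite simple bipartite graph, let $t\geq 2$ be an integer, and suppose that $G$ contains a cycle $C$ of length $\ell\geq 2t$. Then, for every $W\subseteq E(G)$ with $E(C)\subseteq W$, the natural inclusion $$\mathrm{NM}_t(C)=\mathrm{NM}_t(G_{E(C)})\hookrightarrow \mathrm{NM}_t(G_W)$$ induces an injection $$\widetilde H_{2t-3}(\mathrm{NM}_t(C);K)\hookrightarrow \widetilde H_{2t-3}(\mathrm{NM}_t(G_W);K).$$ Consequently, $$\widetilde H_{2t-3}(\mathrm{NM}_t(G_W);K)\neq 0\qquad\text{and}\qquad L_K(\mathrm{NM}_t(G_W))=2t-2$$ for every such $W$. In particular, $L_K(\mathrm{NM}_t(G))=2t-2$.
   Context: All graphs are finite and simple; $E(G)$ denotes the edge set. For $W\subseteq E(G)$, $G_W$ denotes the spanning subgraph of $G$ (vertex set $V(G)$) with edge set $W$. The matching number $\nu(G)$ is the maximum number of pairwise disjoint edges in $G$. For an integer $t\ge 2$, the $t$-non-matching complex of $G$ is the simplicial complex on $E(G)$ given by $\mathrm{NM}_t(G)=\{W\subseteq E(G): \nu(G_W)<t\}$ (isolated vertices of the graph do not affect it). $\widetilde H_q(\,\cdot\,;K)$ is reduced simplicial homology. For a simplicial complex $\Delta$ and a subset $W$ of its vertex set, $\Delta_W$ is the induced subcomplex on $W$. The Leray number $L_K(\Delta)$ is the smallest integer $d\ge 0$ such that $\widetilde H_q(\Delta_W;K)=0$ for every subset $W$ of the vertex set and every $q\ge d$. *)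

(* Defs.v *)
From HB Require Import structures.
From mathcomp Require Import all_boot all_order all_algebra.

Set Implicit Arguments.
Unset Strict Implicit.
Unset Printing Implicit Defensive.

Import GRing.Theory.
Local Open Scope ring_scope.
Local Open Scope quotient_scope.

Record sgraph (T : finType) := SGraph {
  verts : {set T};
  edges : {set {set T}};
  edges_wf : [forall e in edges, (e \subset verts) && (#|e| == 2)]
}.

Definition subgraph (T : finType) (H G : sgraph T) : bool :=
  (verts H \subset verts G) && (edges H \subset edges G).

Lemma spanning_wf (T : finType) (G : sgraph T) (W : {set {set T}}) :
  [forall e in W :&: edges G, (e \subset verts G) && (#|e| == 2)].
Proof.
apply/forall_inP=> e; rewrite inE => /andP[_ eG].
exact: (forall_inP (edges_wf G)).
Qed.

(* G_W: the edge set is W itself when W is a subset of E(G). *)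
Definition spanning (T : finType) (G : sgraph T) (W : {set {set T}}) :
  sgraph T := SGraph (spanning_wf G W).

Definition bipartite (T : finType) (G : sgraph T) : Prop :=
  exists A : {set T}, A \subset verts G /\
    forall e, e \in edges G -> #|e :&: A| = 1%N /\ #|e :\: A| = 1%N.

Definition is_cycle (T : finType) (C : sgraph T) (l : nat) : Prop :=
  exists s : seq T,
    [/\ uniq s, size s = l, (3 <= l)%N,
        verts C = [set x in s] &
        edges C = [set [set x; next s x] | x in s]].

Definition matching_number (T : finType) (G : sgraph T) : nat :=
  \max_(M : {set {set T}} | (M \subset edges G) && trivIset M) #|M|.

(* A complex on the vertex set [vset]; a point of [vset] need not be a face.  *)
Record scomplex (E : finType) := SComplex {
  vset : {set E};
  faces : {set {set E}};
  faces_vset : [forall F in faces, F \subset vset];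
  faces_closed :
    [forall F in faces, forall F' : {set E}, (F' \subset F) ==> (F' \in faces)]
}.

Lemma faces_vsetP (E : finType) (D : scomplex E) (F : {set E}) :
  F \in faces D -> F \subset vset D.
Proof. exact: (forall_inP (faces_vset D)). Qed.

Lemma faces_closedP (E : finType) (D : scomplex E) (F F' : {set E}) :
  F \in faces D -> F' \subset F -> F' \in faces D.
Proof.
by move=> /(forall_inP (faces_closed D)) /forallP /(_ F') /implyP.
Qed.

Section Induced.
Variables (E : finType) (D : scomplex E) (W : {set E}).

Definition induced_faces : {set {set E}} := [set F in faces D | F \subset W].

Lemma induced_vset : [forall F in induced_faces, F \subset W :&: vset D].
Proof.
apply/forall_inP=> F; rewrite inE => /andP[FD FW].
by rewrite subsetI FW faces_vsetP.
Qed.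

Lemma induced_closed :
  [forall F in induced_faces, forall F' : {set E},
     (F' \subset F) ==> (F' \in induced_faces)].
Proof.
apply/forall_inP=> F; rewrite inE => /andP[FD FW].
apply/forallP=> F'; apply/implyP=> F'F.
by rewrite inE (faces_closedP FD F'F) (subset_trans F'F FW).
Qed.

Definition induced : scomplex E := SComplex induced_vset induced_closed.

End Induced.

Section NonMatching.
Variables (T : finType) (t : nat) (G : sgraph T).

Definition NM_faces : {set {set {set T}}} :=
  [set W : {set {set T}} |
     (W \subset edges G) && (matching_number (spanning G W) < t)%N].

Lemma NM_vset : [forall W in NM_faces, W \subset edges G].
Proof. by apply/forall_inP=> W; rewrite inE => /andP[]. Qed.

Lemma NM_closed :
  [forall W in NM_faces, forall W' : {set {set T}},
     (W' \subset W) ==> (W' \in NM_faces)].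
Proof.
apply/forall_inP=> W; rewrite inE => /andP[WG Wt].
apply/forallP=> W'; apply/implyP=> W'W.
rewrite inE (subset_trans W'W WG); apply: leq_ltn_trans Wt.
apply/bigmax_leqP=> M /andP[MW' tM].
apply: leq_bigmax_cond; rewrite tM andbT.
by apply: subset_trans MW' _; apply: setSI.
Qed.

Definition NM : scomplex {set T} := SComplex NM_vset NM_closed.

End NonMatching.

Section VectorQuotient.
Variables (K : fieldType) (V : vectType K) (U : {vspace V}).

Definition vquot : Type := @Quotient.quot V U.
HB.instance Definition _ := GRing.Zmodule.on vquot.
HB.instance Definition _ := EqQuotient.on vquot.

Definition vquot_pi (v : V) : vquot := \pi v.

Lemma vquot_eq (u v : V) : (vquot_pi u == vquot_pi v) = (u - v \in U).
Proof. by rewrite /vquot_pi piE /Quotient.equiv. Qed.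

Lemma vquot_piB (u v : V) : vquot_pi (u - v) = vquot_pi u - vquot_pi v.
Proof. exact: (raddfB (\pi_(@Quotient.quot V U))). Qed.

Lemma vquot_piD (u v : V) : vquot_pi (u + v) = vquot_pi u + vquot_pi v.
Proof. exact: (raddfD (\pi_(@Quotient.quot V U))). Qed.

Lemma vquot_reprK (x : vquot) : vquot_pi (repr x) = x.
Proof. exact: reprK. Qed.

Definition vquot_scale (a : K) (x : vquot) : vquot := vquot_pi (a *: repr x).

Lemma vquot_piZ (a : K) (v : V) :
  vquot_pi (a *: v) = vquot_scale a (vquot_pi v).
Proof.
apply/eqP; rewrite vquot_eq -scalerBr rpredZ // -vquot_eq.
by rewrite vquot_reprK.
Qed.

Lemma vquot_scaleA (a b : K) (x : vquot) :
  vquot_scale a (vquot_scale b x) = vquot_scale (a * b) x.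
Proof. by rewrite -[x]vquot_reprK -!vquot_piZ scalerA. Qed.

Lemma vquot_scale1 : left_id 1 vquot_scale.
Proof. by move=> x; rewrite -[x]vquot_reprK -vquot_piZ scale1r. Qed.

Lemma vquot_scaleDr : right_distributive vquot_scale +%R.
Proof.
move=> a x y; rewrite -[x]vquot_reprK -[y]vquot_reprK.
by rewrite -vquot_piD -!vquot_piZ scalerDr vquot_piD.
Qed.

Lemma vquot_scaleDl (x : vquot) :
  {morph vquot_scale^~ x : a b / a + b}.
Proof.
by move=> a b; rewrite -[x]vquot_reprK -!vquot_piZ scalerDl vquot_piD.
Qed.

HB.instance Definition _ :=
  GRing.Zmodule_isLmodule.Build K vquot
    vquot_scaleA vquot_scale1 vquot_scaleDr vquot_scaleDl.

Lemma vquot_pi_linear : linear vquot_pi.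
Proof. by move=> a u v; rewrite vquot_piD vquot_piZ. Qed.

HB.instance Definition _ :=
  GRing.isLinear.Build K V vquot _ vquot_pi vquot_pi_linear.

Lemma vquot_eq0 (v : V) : (vquot_pi v == 0) = (v \in U).
Proof. by rewrite -(linear0 vquot_pi) vquot_eq subr0. Qed.

End VectorQuotient.

(* Chains of all complexes on subsets of E live in one space, with basis the  *)
(* subsets of E, so the chain map of an inclusion of complexes is the         *)
(* identity. Simplices are oriented by the order [enum_rank] on E. The empty  *)
(* simplex belongs to the chain complex (in degree -1).                       *)
Section Chains.
Variables (K : fieldType) (E : finType).

Definition chain : vectType K := {ffun {set E} -> K^o}.

Definition simplex (F : {set E}) : chain := [ffun F' => (F' == F)%:R].

Definition position (F : {set E}) (x : E) : nat :=
  #|[set y in F | (enum_rank y < enum_rank x)%N]|.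

Definition boundary_fun (c : chain) : chain :=
  \sum_(F : {set E}) c F *:
    \sum_(x in F) (-1) ^+ position F x *: simplex (F :\ x).

Lemma boundary_fun_linear : linear boundary_fun.
Proof.
move=> a u v; rewrite /boundary_fun scaler_sumr -big_split /=.
by apply: eq_bigr => F _; rewrite !ffunE scalerDl scalerA.
Qed.

HB.instance Definition _ :=
  GRing.isLinear.Build K chain chain _ boundary_fun boundary_fun_linear.

Definition boundary : 'End(chain) := linfun boundary_fun.

Lemma boundary_simplex (F : {set E}) :
  boundary (simplex F) =
  \sum_(x in F) (-1) ^+ position F x *: simplex (F :\ x).
Proof.
rewrite lfunE /= /boundary_fun (bigD1 F) //= ffunE eqxx scale1r.
rewrite [X in _ + X]big1 ?addr0 //.
by move=> F' /negPf neF; rewrite ffunE neF scale0r.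
Qed.

Lemma position_D1_gt (F : {set E}) (x y : E) :
  (enum_rank y < enum_rank x)%N -> position (F :\ x) y = position F y.
Proof.
move=> yx; apply: eq_card => z; rewrite !inE.
by case: eqP => [-> | _] //=; rewrite ltnNge ltnW //= andbF.
Qed.

Lemma position_D1_lt (F : {set E}) (x y : E) :
  x \in F -> (enum_rank x < enum_rank y)%N ->
  position F y = (position (F :\ x) y).+1.
Proof.
move=> xF xy; rewrite /position.
rewrite (cardsD1 x) inE xF xy add1n; congr _.+1.
by apply: eq_card => z; rewrite !inE andbA.
Qed.

Lemma boundary_boundary (c : chain) : boundary (boundary c) = 0.
Proof.
have dd F : boundary (boundary (simplex F)) = 0; last first.
  have -> : c = \sum_F c F *: simplex F.
    apply/ffunP=> F; rewrite sum_ffunE (bigD1 F) //= !ffunE eqxx.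
    rewrite big1 ?addr0 => [|F' neF]; first by rewrite [_ *: _]mulr1.
    by rewrite !ffunE eq_sym (negPf neF) [_ *: _]mulr0.
  rewrite !linear_sum big1 // => F _; by rewrite !linearZ /= dd scaler0.
pose f x y : chain :=
  (-1) ^+ position F x *: ((-1) ^+ position (F :\ x) y *: simplex (F :\ x :\ y)).
have f_anti x y : x \in F -> (enum_rank x < enum_rank y)%N ->
  f x y = - f y x.
  move=> xF xy; rewrite /f (position_D1_gt _ xy) (position_D1_lt xF xy).
  rewrite !scalerA exprS mulN1r mulNr scaleNr opprK mulrC.
  by rewrite !setDDl setUC.
rewrite boundary_simplex linear_sum /=.
under eq_bigr => x _ do rewrite linearZ /= boundary_simplex scaler_sumr.
rewrite (eq_bigr (fun x =>
  \sum_(y in F | (enum_rank x < enum_rank y)%N) f x y +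
  \sum_(y in F | (enum_rank y < enum_rank x)%N) f x y)); last first.
  move=> x xF; rewrite (bigID (fun y => (enum_rank x < enum_rank y)%N)) /=.
  congr (_ + _); apply: eq_bigl => y; rewrite !inE.
    case: eqP => [-> | //]; by rewrite ltnn !andbF.
  case: (y =P x) => [-> | /eqP ne]; first by rewrite ltnn andbF.
  rewrite -leqNgt ltn_neqAle; case: eqP => // /val_inj /enum_rank_inj eq.
  by rewrite eq eqxx in ne.
rewrite big_split /=.
have -> : \sum_(x in F) \sum_(y in F | (enum_rank y < enum_rank x)%N) f x y =
  \sum_(x in F) \sum_(y in F | (enum_rank x < enum_rank y)%N) f y x.
  rewrite (exchange_big_dep (mem F)) /= => [|x y _ /andP[] //].
  apply: eq_bigr => x xF; apply: eq_bigl => y.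
  by rewrite -[x \in F]/(x \in mem F) xF.
rewrite -big_split big1 // => x xF; rewrite -big_split big1 //= => y.
by move=> /andP[yF xy]; rewrite f_anti // addNr.
Qed.

(* Indexed by the number n of vertices of a face, i.e. by degree n - 1.       *)
Definition chains (D : scomplex E) (n : nat) : {vspace chain} :=
  <<[seq simplex F | F in [set F in faces D | #|F| == n]]>>%VS.

Definition cycles (D : scomplex E) (q : nat) : {vspace chain} :=
  (chains D q.+1 :&: lker boundary)%VS.

Definition boundaries (D : scomplex E) (q : nat) : {vspace chain} :=
  (boundary @: chains D q.+2)%VS.

Lemma boundaries_cycles (D : scomplex E) (q : nat) :
  (boundaries D q <= cycles D q)%VS.
Proof.
apply/subvP=> b /memv_imgP[c cD ->]; rewrite memv_cap memv_ker.
rewrite boundary_boundary eqxx andbT.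
apply: (subvP _ _ (memv_img boundary cD)); rewrite limg_span.
apply/span_subvP => b'.
case/mapP=> s /imageP[F]; rewrite inE => /andP[FD /eqP nF] -> ->.
rewrite boundary_simplex; apply: rpred_sum => x xF; apply: rpredZ.
apply: memv_span; apply/imageP; exists (F :\ x) => //.
rewrite inE (faces_closedP FD) ?subD1set //=.
by move: nF; rewrite (cardsD1 x) xF add1n => -[->].
Qed.

Definition homology (D : scomplex E) (q : nat) : lmodType K :=
  vquot (linfun (@vsval K chain (cycles D q)) @^-1: boundaries D q)%VS.

Definition homology_class (D : scomplex E) (q : nat)
  (z : subvs_of (cycles D q)) : homology D q := vquot_pi _ z.

Lemma chains_sub (D D' : scomplex E) (n : nat) :
  faces D \subset faces D' -> (chains D n <= chains D' n)%VS.
Proof.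
move=> /subsetP sub; apply: sub_span => c /imageP[F].
rewrite inE => /andP[FD nF] ->; apply/imageP; exists F => //.
by rewrite inE nF sub.
Qed.

Lemma cycles_sub (D D' : scomplex E) (q : nat) :
  faces D \subset faces D' -> (cycles D q <= cycles D' q)%VS.
Proof. by move=> sub; apply: capvS => //; apply: chains_sub. Qed.

Lemma boundaries_sub (D D' : scomplex E) (q : nat) :
  faces D \subset faces D' -> (boundaries D q <= boundaries D' q)%VS.
Proof. by move=> sub; apply: limgS; apply: chains_sub. Qed.

Section Inclusion.
Variables (D D' : scomplex E) (q : nat).
Hypothesis sub : faces D \subset faces D'.

Definition cycle_incl (z : subvs_of (cycles D q)) : subvs_of (cycles D' q) :=
  Subvs (subvP (cycles_sub q sub) (vsval z) (subvsP z)).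

Definition homology_map (h : homology D q) : homology D' q :=
  homology_class (cycle_incl (repr h)).

Lemma homology_mapE (z : subvs_of (cycles D q)) :
  homology_map (homology_class z) = homology_class (cycle_incl z).
Proof.
apply/eqP; rewrite vquot_eq -memv_preim lfunE /=.
apply: (subvP (boundaries_sub q sub)).
have /eqP := vquot_reprK (homology_class z).
by rewrite vquot_eq -memv_preim lfunE.
Qed.

Lemma homology_map_linear : linear homology_map.
Proof.
move=> a x y; rewrite -[x]vquot_reprK -[y]vquot_reprK.
rewrite -linearP !homology_mapE -linearP.
by congr homology_class; apply: val_inj.
Qed.

HB.instance Definition _ :=
  GRing.isLinear.Build K (homology D q) (homology D' q) _ homology_map
    homology_map_linear.

End Inclusion.

End Chains.

Arguments homology_map K {E D D'} q sub h.

Definition leray_bound (K : fieldType) (E : finType) (D : scomplex E)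
  (d : nat) : Prop :=
  forall W : {set E}, W \subset vset D ->
  forall q : nat, (d <= q)%N -> forall h : homology K (induced D W) q, h = 0.

(* L_K(D) = d, i.e. d is the least bound; such a d is unique, and exists since
   homology vanishes in degrees at least #|E|. *)
Definition leray_number_is (K : fieldType) (E : finType) (D : scomplex E)
  (d : nat) : Prop :=
  leray_bound K D d /\ forall d' : nat, leray_bound K D d' -> (d <= d')%N.

(* Main.v *)
(* With k = t - 1 and d = 2 k, filter NM_t(G) by the value of an optimal flow. On a
   set F of edges, a flow may carry N + 1 units through each vertex of A and N
   through each other vertex (N large), and maximizes a generic linear cost which
   rewards the total flow first; let x(F) be the optimum. Linear programming
   duality and Koenig's theorem give three facts. The sets F in NM_t(G) sharing
   one x = x(F) form an interval [supp x, tau]: the dual solution is determined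
   by x, since (N + 1) p = N q has no small nonzero solution. Membership in NM_t(G)
   depends only on x(F), as it means that the total flow is at most k (N + 1). The
   support of x has at most as many elements as there are saturated vertices,
   hence at most d.

   So a face F with more than d elements contains an edge outside supp x(F), which
   toggles its whole fibre; chains are pushed down the filtration along such edges
   and homology vanishes in degrees at least d.

   For the cycle C, NM_t(C) has no face with more than d edges, so a face F1 of top
   value in a nonzero (d-1)-cycle z is alone in its fibre. If the edges off C have
   very large costs, F1 remains alone in its fibre inside NM_t(G_W), because any
   further edge would be used by the optimal flow. If z bounded w, pushing w below
   the value of F1 would leave no face above F1, a contradiction.

   Finally NM_t(C) carries a nonzero cycle: the k-th divided power of the closed
   2-form sum_i e_i ^ e_(i+1), over the edges e_i in cyclic order. *)

From HB Require Import structures.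
Require Import Defs.
From mathcomp Require Import all_boot all_order all_algebra.
From mathcomp Require Import zify ring.

Set Implicit Arguments.
Unset Strict Implicit.
Unset Printing Implicit Defensive.

Import Order.TTheory GRing.Theory Num.Theory.
Local Open Scope ring_scope.

(** * Flows in bipartite graphs and their duals *)

Section Potentials.
Variables (V : finType) (R : rel V) (g : V -> V -> int).

Fixpoint path_gain (u : V) (s : seq V) : int :=
  if s is v :: s' then g u v + path_gain v s' else 0.

Lemma path_gain_cat (u : V) (s1 s2 : seq V) :
  path_gain u (s1 ++ s2) = path_gain u s1 + path_gain (last u s1) s2.
Proof.
by elim: s1 u => [|v s1 IH] u /=; rewrite ?add0r // IH addrA.
Qed.

Lemma path_gain_nth (u : V) (s : seq V) :
  path_gain u s = \sum_(i < size s) g (nth u (u :: s) i) (nth u s i).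
Proof.
elim: s u => [|v s IH] u /=; first by rewrite big_ord0.
rewrite big_ord_recl /= IH; congr (_ + _); apply: eq_bigr => i _.
congr (g _ _); apply: set_nth_default => //=.
by rewrite ltnS ltnW.
Qed.

Lemma cycle_gain (u : V) (s : seq V) : uniq (u :: s) ->
  \sum_(v <- u :: s) g v (next (u :: s) v) = path_gain u (rcons s u).
Proof.
move=> us; rewrite path_gain_nth (big_nth u) big_mkord size_rcons.
apply: eq_bigr => i _.
have li : (i < size (u :: s))%N := ltn_ord i.
by rewrite next_nth mem_nth // index_uniq // -rcons_cons !nth_rcons_default.
Qed.

Hypothesis no_pos_cycle : forall s, uniq s -> cycle R s ->
  \sum_(v <- s) g v (next s v) <= 0.

(* The potential of u is the largest gain of a simple path starting at u. *)
Lemma potential : exists p : V -> int,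
  forall u v, R u v -> g u v + p v <= p u.
Proof.
(* Sequences of bounded length form a finite type, so a simple path of largest gain exists. *)
pose ok u (s : #|V|.-bseq V) := path R u s && uniq (u :: s).
have best u : exists s : #|V|.-bseq V, ok u s /\
    forall s', ok u s' -> path_gain u s' <= path_gain u s.
  have ok0 : ok u [bseq] by [].
  case: (@Order.TotalTheory.arg_maxP _ _ _ _ (ok u) (fun s => path_gain u s) ok0) => s oks ms.
  by exists s; split=> // s' /ms.
have [b bP] := fin_all_exists best; clear best.
exists (fun u => path_gain u (b u)) => u v uv.
have [/andP[pv uv'] _] := bP v; have [_ mu] := bP u.
have bseqify (s : seq V) : uniq (u :: s) ->
    exists s' : #|V|.-bseq V, bseqval s' = s.
  move=> us; have ls : (size s <= #|V|)%N.
    by apply: leq_trans (max_card (mem (u :: s))); rewrite (card_uniqP us) /=.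
  by exists (Bseq ls).
have [ub | nub] := boolP (u \in v :: b v); last first.
  have us : uniq (u :: v :: b v) by rewrite cons_uniq nub.
  have [s' s'E] := bseqify _ us.
  by have := mu s'; rewrite /ok s'E us /= uv pv; apply.
(* The best path from [v] now visits [u]. Its part up to [u] closes a cycle of gain at most 0, and
   the rest [s2] competes with the best path from [u]. *)
have [s1 [s2 E]] : exists s1 s2, v :: b v = s1 ++ u :: s2.
  by case/splitPr: ub => s1 s2; exists s1, s2.
have us2 : uniq (u :: s2) by move: uv'; rewrite E cat_uniq => /and3P[].
have gvb : path_gain v (b v) = path_gain u (s1 ++ [:: u]) - g u v + path_gain u s2
  /\ path R u (s1 ++ u :: s2).
  rewrite -E /= uv pv; split => //.
  have : path_gain u (v :: b v) = path_gain u (s1 ++ u :: s2) by rewrite E.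
  by rewrite !path_gain_cat /=; lia.
case: gvb => -> /[!cat_path] /= /and3P[p1 lu p2].
have ps2 : path_gain u s2 <= path_gain u (b u).
  have [s' s'E] := bseqify _ us2.
  by have := mu s'; rewrite /ok s'E p2 us2; apply.
have us1 : uniq (u :: s1).
  by move: uv'; rewrite E -cat_rcons cat_uniq rcons_uniq => /and3P[].
have cyc : cycle R (u :: s1) by rewrite /= rcons_path p1.
have := no_pos_cycle us1 cyc; rewrite cycle_gain // -cats1 => c0.
by rewrite addrA [X in X + _]addrC subrK -[leRHS]add0r lerD.
Qed.

End Potentials.

(** * Residual graphs and optimal duals of bipartite flows *)

Section Flows.
Variables (E T : finType) (A : {set T}) (ea eb : E -> T) (EG : {set E}).

Definition incid (e : E) (v : T) : nat := (ea e == v) + (eb e == v).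
Definition load (x : E -> nat) (v : T) : nat := (\sum_e x e * incid e v)%N.

Definition feasible (w : T -> nat) (F : {set E}) (x : {ffun E -> nat}) : Prop :=
  (forall e, x e != 0%N -> e \in F) /\ forall v, (load x v <= w v)%N.

Definition cost (c : E -> nat) (x : E -> nat) : nat := (\sum_e c e * x e)%N.

Definition optimal (w : T -> nat) (c : E -> nat) (F : {set E})
    (x : {ffun E -> nat}) : Prop :=
  feasible w F x /\ forall x', feasible w F x' -> (cost c x' <= cost c x)%N.

(** A solution of the dual program, a weighted vertex cover, with both complementary slackness
    conditions towards [x]. *)
Definition dual (w : T -> nat) (c : E -> nat) (F : {set E})
    (x : E -> nat) (y : T -> nat) : Prop :=
  [/\ forall e, e \in F -> (c e <= y (ea e) + y (eb e))%N,
      forall e, x e != 0%N -> c e = (y (ea e) + y (eb e))%N &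
      forall v, (load x v < w v)%N -> y v = 0%N].

Definition bipartition : Prop :=
  (forall e, e \in EG -> ea e \in A /\ eb e \notin A) /\
  {in EG &, forall e f, ea e = ea f -> eb e = eb f -> e = f}.

Hypothesis EGP : bipartition.

Lemma eaA e : e \in EG -> ea e \in A.
Proof. by case: EGP => h _ /h[]. Qed.

Lemma ebA e : e \in EG -> (eb e \in A) = false.
Proof. by case: EGP => h _ /h[_ /negbTE]. Qed.

Lemma ends_inj : {in EG &, forall e f, ea e = ea f -> eb e = eb f -> e = f}.
Proof. by case: EGP. Qed.

Lemma incidE e v : e \in EG ->
  incid e v = (if v \in A then ea e == v else eb e == v).
Proof.
move=> eG; rewrite /incid; case: ifP => vA.
  suff -> : (eb e == v) = false by rewrite addn0.
  by apply: contraTF vA => /eqP <-; rewrite ebA.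
suff -> : (ea e == v) = false by [].
by apply: contraFF vA => /eqP <-; rewrite eaA.
Qed.

Section Residual.
Variables (w : T -> nat) (c : E -> nat) (F : {set E}) (x : {ffun E -> nat}).
Hypothesis FG : F \subset EG.
Hypothesis xopt : optimal w c F x.

Let FGe e : e \in F -> e \in EG := fun h => subsetP FG e h.

Let slack v := (load x v < w v)%N.

(* None is an auxiliary root: an alternating path leaving v through the root
   changes the load of v. *)
Definition residual (u v : option T) : bool :=
  match u, v with
  | Some a, Some b =>
      [exists e in F, (ea e == a) && (eb e == b)] ||
      [exists e in F, [&& x e != 0%N, ea e == b & eb e == a]]
  | None, Some v => (v \in A) ==> slack v
  | Some u, None => (u \notin A) ==> slack u
  | None, None => false
  end.

(** A unit added on an edge earns its cost, a unit removed loses it, and root arcs are free. Being a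
    sum over edges, it can be exchanged with the sum along a cycle. *)
Definition residual_gain (u v : option T) : int :=
  \sum_(e in F) (c e)%:Z *
    (((u == Some (ea e)) && (v == Some (eb e)))%:Z -
     ((u == Some (eb e)) && (v == Some (ea e)))%:Z).

Lemma residual_fwd e : e \in F -> residual (Some (ea e)) (Some (eb e)).
Proof.
by move=> eF; apply/orP; left; apply/existsP; exists e; rewrite eF !eqxx.
Qed.

Lemma residual_bwd e : e \in F -> x e != 0%N ->
  residual (Some (eb e)) (Some (ea e)).
Proof.
by move=> eF xe; apply/orP; right; apply/existsP; exists e; rewrite eF xe !eqxx.
Qed.

Lemma residual_bwdP a b : a \in A -> residual (Some b) (Some a) ->
  exists e, [/\ e \in F, x e != 0%N, ea e = a & eb e = b].
Proof.
move=> aA /orP[] /existsP[e /andP[eF]].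
  by move=> /andP[_ /eqP ab]; rewrite -ab ebA ?FGe in aA.
by case/and3P=> xe /eqP <- /eqP <-; exists e.
Qed.

Lemma residual_gain_fwd e : e \in F ->
  residual_gain (Some (ea e)) (Some (eb e)) = (c e)%:Z.
Proof.
move=> eF; rewrite /residual_gain (bigD1 e) //= !eqxx /= big1 => [|f].
  suff -> : (Some (ea e) == Some (eb e)) = false by rewrite addr0 subr0 mulr1.
  by apply/eqP=> -[h]; have := eaA (FGe eF); rewrite h ebA ?FGe.
case/andP=> fF ne.
have -> : (Some (ea e) == Some (eb f)) = false.
  by apply/eqP=> -[h]; have := eaA (FGe eF); rewrite h ebA ?FGe.
case: eqP => [[h]|_]; last by rewrite mulr0.
case: eqP => [[h']|_]; last by rewrite mulr0.
by case/eqP: ne; apply: ends_inj; rewrite ?FGe.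
Qed.

Lemma residual_gain_bwd e : e \in F ->
  residual_gain (Some (eb e)) (Some (ea e)) = - (c e)%:Z.
Proof.
move=> eF; rewrite -residual_gain_fwd // /residual_gain -sumrN.
by apply: eq_bigr => f _; rewrite -mulrN opprB andbC [X in _ - (nat_of_bool X)%:Z]andbC.
Qed.

(** Rerouting one unit along the cycle yields a feasible flow [x'] whose cost exceeds that of [x] by
    the gain of the cycle. *)
Lemma no_augmenting (s : seq (option T)) : uniq s -> cycle residual s ->
  \sum_(v <- s) residual_gain v (next s v) <= 0.
Proof.
move=> us cs.
pose up e := (Some (ea e) \in s) && (next s (Some (ea e)) == Some (eb e)).
pose dn e := (Some (eb e) \in s) && (next s (Some (eb e)) == Some (ea e)).
pose x' := [ffun e => if e \in F then (x e + up e - dn e)%N else 0%N].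
(* Edges run backwards carry flow, so the truncated subtraction in [x'] is exact. *)
have dnx e : e \in F -> dn e -> x e != 0%N.
  move=> eF /andP[es /eqP ne]; have := next_cycle cs es; rewrite ne.
  case/(residual_bwdP (eaA (FGe eF))) => f [fF xf h1 h2].
  by rewrite (_ : e = f) //; apply: ends_inj; rewrite ?FGe.
have x'E e : e \in F -> (x' e + dn e = x e + up e)%N.
  move=> eF; rewrite ffunE eF; move: (dnx e eF); case: (dn e) => h.
    by rewrite subnK // addn_gt0 lt0n h.
  by rewrite subn0 addn0.
have xF e : e \notin F -> x e = 0%N.
  by move=> eF; apply/eqP; apply: contraR eF; case: xopt => -[h _] _ /h.
have x'F e : e \notin F -> x' e = 0%N by rewrite ffunE => /negbTE ->.
have loadE v : (load x' v + \sum_(e in F) dn e * incid e v =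
                load x v + \sum_(e in F) up e * incid e v)%N.
  rewrite /load (bigID (mem F)) /= [X in (_ + X + _ = _)%N]big1 => [|e /x'F -> //].
  rewrite [X in (_ = X + _)%N](bigID (mem F)) /=.
  rewrite [X in (_ = _ + X + _)%N]big1 => [|e /xF -> //].
  rewrite !addn0 -!big_split /=; apply: eq_bigr => e eF.
  by rewrite -!mulnDl x'E.
have xfeas : feasible w F x'.
  split=> [e|v]; first by have [//|eF] := boolP (e \in F); rewrite x'F.
  have xw : (load x v <= w v)%N by case: xopt => -[].
  have := loadE v; set D := (\sum_(e in F) dn e * _)%N; set U := (\sum_(e in F) up e * _)%N.
  move=> LE.
  have [U0|Upos] := posnP U; first by rewrite U0 addn0 in LE; rewrite (leq_trans _ xw) // -LE leq_addr.
  (* A simple cycle adds at most one unit at [v]. Its other arc at [v] then either removes a unit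
     there or joins [v] to the root in the direction that requires slack. *)
  suff [U1 dnU] : U = 1%N /\ (slack v \/ (0 < D)%N).
    rewrite U1 addn1 in LE; case: dnU => [sv | Dpos].
      by apply: leq_trans sv; rewrite -LE leq_addr.
    by rewrite (leq_trans _ xw) // -ltnS -LE -addn1 leq_add2l.
  have {Upos} [e [eF upe ev]] : exists e, [/\ e \in F, up e & incid e v != 0%N].
    move: Upos; rewrite lt0n sum_nat_eq0 negb_forall => /existsP[e].
    rewrite negb_imply muln_eq0 negb_or eqb0 negbK => /andP[eF /andP[? ?]].
    by exists e.
  have inF f : f \in F -> incid f v = (if v \in A then ea f == v else eb f == v).
    by move=> fF; apply: incidE; apply: FGe.
  have Dpos f : f \in F -> dn f -> incid f v != 0%N -> (0 < D)%N.
    move=> fF dnf fv; rewrite /D (bigD1 f) //= dnf mul1n.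
    by rewrite addn_gt0 lt0n fv.
  move: (upe) => /andP[es /eqP nes].
  have [vA | vA] := boolP (v \in A).
    have eav : ea e = v by move: ev; rewrite inF // vA eqb0 negbK => /eqP.
    split.
      rewrite /U (bigD1 e) //= upe mul1n inF // vA eav eqxx big1 // => f.
      case/andP=> fF /eqP ne; rewrite inF // vA.
      have [/andP[_ /eqP nf]|//] := boolP (up f).
      case: eqP => // fv; case: ne; apply: ends_inj; rewrite ?FGe // ?fv //.
      by move: nf; rewrite fv -eav nes => -[->].
    rewrite eav in es; have := prev_cycle cs es.
    have vp : next s (prev s (Some v)) = Some v by rewrite next_prev.
    have ps : prev s (Some v) \in s by rewrite mem_prev.
    case En : (prev s (Some v)) ps vp => [b|] ps vp; last by rewrite /= vA; left.
    case/(residual_bwdP vA) => f [fF xf h1 h2]; right; apply: (Dpos f) => //.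
      by rewrite /dn h1 h2 ps vp eqxx.
    by rewrite inF // vA h1 eqxx.
  have ebv : eb e = v by move: ev; rewrite inF // (negbTE vA) eqb0 negbK => /eqP.
  have vs : Some v \in s by rewrite -ebv -nes mem_next.
  split.
    rewrite /U (bigD1 e) //= upe mul1n inF // (negbTE vA) ebv eqxx big1 // => f.
    case/andP=> fF /eqP ne; rewrite inF // (negbTE vA).
    have [/andP[_ /eqP nf]|//] := boolP (up f).
    case: eqP => // fv; case: ne; apply: ends_inj; rewrite ?FGe // ?fv //.
    have : next s (Some (ea f)) = next s (Some (ea e)) by rewrite nf nes fv ebv.
    by move/(can_inj (prev_next us)) => -[].
  have := next_cycle cs vs.
  case En : (next s (Some v)) => [a|]; last by rewrite /= vA; left.
  have [aA | aA] := boolP (a \in A); last first.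
    case/orP=> /existsP[f /andP[fF]].
      by case/andP=> /eqP h; have := eaA (FGe fF); rewrite h (negbTE vA).
    by case/and3P=> _ /eqP h; have := eaA (FGe fF); rewrite h (negbTE aA).
  case/(residual_bwdP aA) => f [fF xf h1 h2]; right; apply: (Dpos f) => //.
    by rewrite /dn h1 h2 vs En eqxx.
  by rewrite inF // (negbTE vA) h2 eqxx.
have pick1 (a : option T) (P : pred (option T)) :
    \sum_(v <- s) ((v == a) && P v)%:Z = ((a \in s) && P a)%:Z :> int.
  have [ain | aout] := boolP (a \in s).
    rewrite (bigD1_seq a) //= eqxx big1 ?addr0 // => v.
    by move=> /negbTE ->.
  rewrite big1_seq // => v /andP[_ vs]; case: eqP => // h.
  by rewrite -h vs in aout.
have -> : \sum_(v <- s) residual_gain v (next s v) =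
    (cost c x')%:Z - (cost c x)%:Z.
  rewrite /residual_gain exchange_big /=.
  transitivity (\sum_(e in F) ((c e)%:Z * ((up e)%:Z - (dn e)%:Z))).
    apply: eq_bigr => e eF; rewrite -big_distrr /=; congr (_ * _).
    by rewrite big_split sumrN !pick1.
  rewrite /cost !(bigID (mem F) xpredT) /=.
  rewrite [X in (_ + X)%N%:Z - _]big1 => [|e /x'F ->]; last by rewrite muln0.
  rewrite [X in _ - (_ + X)%N%:Z]big1 => [|e /xF ->]; last by rewrite muln0.
  rewrite !addn0 -!natz !natr_sum -sumrB; apply: eq_bigr => e eF.
  rewrite !natrM -mulrBr !natz; congr (_ * _); have := x'E e eF.
  by move/(congr1 Posz); rewrite !PoszD => h; apply/eqP; rewrite subr_eq addrAC h addrAC subrr add0r.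
by rewrite subr_le0 lez_nat; apply: xopt.2.
Qed.

(** Dual values are differences of potential with the root, with a sign for each side. The root arcs
    always present make them nonnegative, those requiring slack make them vanish at unsaturated
    vertices, and the arcs along edges give the other conditions. *)
Lemma optimal_dual : exists y, dual w c F x y.
Proof.
have [p pP] := potential no_augmenting.
pose y v := absz (if v \in A then p (Some v) - p None else p None - p (Some v)).
have g0 u : residual_gain u None = 0 /\ residual_gain None u = 0.
  by split; apply: big1 => e _; rewrite ?andbF mulr0.
have yA v : v \in A -> (y v)%:Z = p (Some v) - p None.
  move=> vA; rewrite /y vA gez0_abs // subr_ge0.
  by have := pP (Some v) None; rewrite (g0 _).1 add0r /= vA; apply.
have yB v : v \notin A -> (y v)%:Z = p None - p (Some v).
  move=> vA; rewrite /y (negbTE vA) gez0_abs // subr_ge0.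
  by have := pP None (Some v); rewrite (g0 _).2 add0r /= (negbTE vA); apply.
have yE e : e \in F -> (y (ea e) + y (eb e))%:Z = p (Some (ea e)) - p (Some (eb e)).
  move=> eF; rewrite PoszD yA ?eaA ?FGe // yB ?ebA ?FGe //; ring.
have yge e : e \in F -> (c e <= y (ea e) + y (eb e))%N.
  move=> eF; rewrite -lez_nat yE //.
  by have := pP _ _ (residual_fwd eF); rewrite residual_gain_fwd // lerBrDr.
exists y; split=> // [e xe | v sv].
  have eF : e \in F by case: xopt => -[h _] _; apply: h.
  apply/eqP; rewrite eqn_leq yge //= -lez_nat yE //.
  have := pP _ _ (residual_bwd eF xe); rewrite residual_gain_bwd //.
  by rewrite lerBlDr addrC lerBlDr addrC.
apply/eqP; rewrite -leqn0 -lez_nat; have [vA | vA] := boolP (v \in A).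
  rewrite yA // subr_le0; have := pP None (Some v).
  by rewrite (g0 _).2 add0r /= vA; apply.
rewrite yB // subr_le0; have := pP (Some v) None.
by rewrite (g0 _).1 add0r /= vA; apply.
Qed.

End Residual.
End Flows.

(** * Linear programming duality and Koenig's theorem *)

Section Optima.
Variables (E T : finType) (A : {set T}) (ea eb : E -> T) (EG : {set E}).
Hypothesis EGP : bipartition A ea eb EG.

Local Notation load := (load ea eb).
Local Notation feasible := (feasible ea eb).
Local Notation optimal := (optimal ea eb).
Local Notation dual := (dual ea eb).

Lemma sum_incid (y : T -> nat) e :
  (\sum_v y v * incid ea eb e v = y (ea e) + y (eb e))%N.
Proof.
rewrite (eq_bigr (fun v => (ea e == v) * y v + (eb e == v) * y v)%N) => [|v _].
  rewrite big_split /=; congr (_ + _)%N.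
    by rewrite (bigD1 (ea e)) //= eqxx mul1n big1 ?addn0 // => v /negbTE ne; rewrite eq_sym ne.
  by rewrite (bigD1 (eb e)) //= eqxx mul1n big1 ?addn0 // => v /negbTE ne; rewrite eq_sym ne.
by rewrite mulnC mulnDl.
Qed.

(** Double counting; with an indicator function for [y] it counts the flow at a set of vertices. *)
Lemma weighted_load (y : T -> nat) (x : E -> nat) :
  (\sum_v y v * load x v = \sum_e (y (ea e) + y (eb e)) * x e)%N.
Proof.
rewrite (eq_bigr (fun v => \sum_e y v * (x e * incid ea eb e v)))%N => [|v _].
  rewrite exchange_big /=; apply: eq_bigr => e _.
  rewrite -sum_incid big_distrl /=; apply: eq_bigr => v _.
  by rewrite mulnA mulnAC.
by rewrite big_distrr.
Qed.

(** Complementary slackness gives equality in the weak duality of [cost_le_dual]. *)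
Lemma dual_cost w c F x y : feasible w F x -> dual w c F x y ->
  cost c x = (\sum_v w v * y v)%N.
Proof.
move=> [_ xw] [_ d2 d3].
transitivity (\sum_v y v * load x v)%N.
  rewrite weighted_load; apply: eq_bigr => e _.
  by have [-> | /d2 ->] := eqVneq (x e) 0%N; rewrite ?muln0.
apply: eq_bigr => v _; rewrite mulnC.
have [lt|] := ltnP (load x v) (w v); first by rewrite d3 ?muln0.
by move=> ge; congr (_ * _)%N; apply/eqP; rewrite eqn_leq xw.
Qed.

Lemma cost_le_dual w c F x x' y : feasible w F x' -> dual w c F x y ->
  (cost c x' <= \sum_v w v * y v)%N.
Proof.
move=> [x'F x'w] [d1 _ _].
apply: (@leq_trans (\sum_v y v * load x' v)).
  rewrite weighted_load; apply: leq_sum => e _.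
  have [-> | /x'F eF] := eqVneq (x' e) 0%N; first by rewrite !muln0.
  by rewrite leq_mul2r d1 ?orbT.
by apply: leq_sum => v _; rewrite mulnC leq_mul2r x'w orbT.
Qed.

Lemma dual_optimal w c F x y : feasible w F x -> dual w c F x y ->
  optimal w c F x.
Proof.
move=> fx dy; split=> // x' fx'.
by rewrite (dual_cost fx dy); apply: cost_le_dual fx' dy.
Qed.

Lemma feasible_le w F x e : feasible w F x -> (x e <= w (ea e))%N.
Proof.
move=> [_ xw]; apply: leq_trans (xw (ea e)).
rewrite /load (bigD1 e) //= /incid eqxx.
by rewrite (leq_trans _ (leq_addr _ _)) // leq_pmulr.
Qed.

Lemma exists_optimal w c F : exists x, optimal w c F x.
Proof.
pose m := (\sum_v w v)%N.
pose val (x : {ffun E -> 'I_m.+1}) : {ffun E -> nat} := [ffun e => x e : nat].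
pose ok x := [forall e, (val x e != 0%N) ==> (e \in F)] &&
             [forall v, (load (val x) v <= w v)%N].
have okP x : reflect (feasible w F (val x)) (ok x).
  apply: (iffP andP) => -[h1 h2]; split.
  - by move=> e; apply/implyP; apply: (forallP h1).
  - by move=> v; apply: (forallP h2).
  - by apply/forallP=> e; apply/implyP; apply: h1.
  - by apply/forallP.
have ok0 : ok [ffun=> ord0].
  apply/okP; split=> [e|v]; first by rewrite !ffunE.
  by rewrite /load big1 // => e _; rewrite !ffunE.
case: (arg_maxnP (fun x => cost c (val x)) ok0) => x /okP fx mx.
exists (val x); split=> // x' fx'.
have le e : (x' e < m.+1)%N.
  rewrite ltnS (leq_trans (feasible_le e fx')) // /m (bigD1 (ea e)) //=.
  exact: leq_addr.
have E' : val [ffun e => Ordinal (le e)] = x'.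
  by apply/ffunP=> e; rewrite !ffunE.
by rewrite -E'; apply: mx; apply/okP; rewrite E'.
Qed.

Definition total (x : E -> nat) : nat := (\sum_e x e)%N.

Lemma cost1 (x : E -> nat) : cost (fun=> 1%N) x = total x.
Proof. by apply: eq_bigr => e _; rewrite mul1n. Qed.

Definition covers (S : {set T}) (F : {set E}) : Prop :=
  forall e, e \in F -> (ea e \in S) || (eb e \in S).

Lemma total_le_cover w (S : {set T}) F x : feasible w F x -> covers S F ->
  (total x <= \sum_(v in S) w v)%N.
Proof.
move=> [xF xw] cS; apply: (@leq_trans (\sum_(v in S) load x v)); last first.
  exact: leq_sum.
have := weighted_load (fun v => v \in S) x.
rewrite (bigID (mem S)) /= [X in (_ + X)%N]big1 ?addn0 => [|v /negbTE -> //].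
rewrite (eq_bigr (load x)) => [->|v ->]; last by rewrite mul1n.
apply: leq_sum => e _.
have [-> // | /xF /cS h] := eqVneq (x e) 0%N.
by rewrite leq_pmull // addn_gt0 !lt0b.
Qed.

Lemma total_left (F : {set E}) (x : E -> nat) : F \subset EG -> (forall e, x e != 0%N -> e \in F) ->
  total x = (\sum_(v in A) load x v)%N.
Proof.
move=> /subsetP FG xF; have := weighted_load (fun v => v \in A) x.
rewrite (bigID (mem A)) /= [X in (_ + X)%N]big1 ?addn0 => [|v /negbTE -> //].
rewrite (eq_bigr (load x)) => [->|v ->]; last by rewrite mul1n.
apply: eq_bigr => e _.
have [-> | /xF /FG h] := eqVneq (x e) 0%N; first by rewrite muln0.
by rewrite (eaA EGP) ?(ebA EGP) // mul1n.
Qed.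

Lemma total_right (F : {set E}) (x : E -> nat) : F \subset EG -> (forall e, x e != 0%N -> e \in F) ->
  total x = (\sum_(v in ~: A) load x v)%N.
Proof.
move=> /subsetP FG xF; have := weighted_load (fun v => v \in ~: A) x.
rewrite (bigID (mem (~: A))) /= [X in (_ + X)%N]big1 ?addn0 => [|v /negbTE -> //].
rewrite (eq_bigr (load x)) => [->|v ->]; last by rewrite mul1n.
apply: eq_bigr => e _.
have [-> | /xF /FG h] := eqVneq (x e) 0%N; first by rewrite muln0.
by rewrite !inE (eaA EGP) ?(ebA EGP) // mul1n.
Qed.

Definition matching_le (k : nat) (F : {set E}) : Prop :=
  forall M : {set E}, M \subset F -> {in M &, injective ea} ->
    {in M &, injective eb} -> (#|M| <= k)%N.

(** For unit capacities and costs, the support of an optimal flow is a matching and the support of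
    an optimal dual is a cover; duality compares their sizes. *)
Lemma koenig k (F : {set E}) : F \subset EG -> matching_le k F ->
  exists S : {set T}, covers S F /\ (#|S| <= k)%N.
Proof.
move=> FG mF; have [x xopt] := exists_optimal (fun=> 1%N) (fun=> 1%N) F.
have [y dy] := optimal_dual EGP FG xopt.
have [fx _] := xopt; have [xF xw] := fx; have [d1 d2 d3] := dy.
pose M := [set e | x e != 0%N].
have load1 e f : e \in M -> f \in M -> e != f ->
    ea e != ea f /\ eb e != eb f.
  rewrite !inE -!lt0n => xe xf ne.
  have two v : (incid ea eb e v + incid ea eb f v <= 1)%N.
    apply: leq_trans (xw v); rewrite /load (bigD1 e) //= (bigD1 f) 1?eq_sym //=.
    rewrite addnA (leq_trans _ (leq_addr _ _)) // leq_add // leq_pmull //.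
  split; apply/eqP=> h.
    by have := two (ea e); rewrite /incid -h eqxx addnAC; case: eqP; case: eqP.
  by have := two (eb e); rewrite /incid -h eqxx; case: eqP; case: eqP.
exists [set v | y v != 0%N]; split.
  move=> e /d1; rewrite !inE -!lt0n -addn_gt0; exact: leq_trans.
have -> : #|[set v | y v != 0%N]| = (\sum_(v | y v != 0%N) 1)%N.
  by rewrite sum1_card; apply: eq_card => v; rewrite !inE.
apply: (@leq_trans (\sum_v 1 * y v)).
  rewrite [leqRHS](bigID (fun v => y v != 0%N)) /= (leq_trans _ (leq_addr _ _)) //.
  by apply: leq_sum => v; rewrite mul1n lt0n.
rewrite -(dual_cost fx dy) cost1.
apply: leq_trans (mF M _ _ _).
- rewrite /total (bigID (mem M)) /= [X in (_ + X)%N]big1 => [|e].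
    rewrite addn0 -sum1_card; apply: leq_sum => e _.
    exact: (feasible_le e fx).
  by rewrite inE negbK => /eqP.
- by apply/subsetP=> e; rewrite inE => /xF.
- move=> e f eM fM h; apply/eqP; apply: contraT => ne.
  by have [] := load1 e f eM fM ne; rewrite h eqxx.
- move=> e f eM fM h; apply/eqP; apply: contraT => ne.
  by have [] := load1 e f eM fM ne; rewrite h eqxx.
Qed.

End Optima.

(** * Generic weights *)

Lemma poly_nonroot_ge (p : {poly rat}) (n0 : nat) : p != 0 ->
  exists n, (n0 <= n)%N /\ p.[n%:R] != 0.
Proof.
move=> p0; pose s : seq rat := [seq i%:R | i <- iota n0 (size p)].
have [rs | /allPn[x /mapP[i]]] := boolP (all (root p) s); last first.
  by rewrite mem_iota => /andP[ni _] -> rp; exists i.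
have us : uniq s by rewrite map_inj_uniq ?iota_uniq // => i j /eqP; rewrite eqr_nat => /eqP.
by have := max_poly_roots p0 rs us; rewrite size_map size_iota ltnn.
Qed.

Lemma sum_expn_lt (I : finType) (P : {pred I}) (r : I -> nat) (B n R : nat) :
  (B * #|I| < n)%N -> (forall i, i \in P -> r i < R)%N ->
  (B * \sum_(i in P) n ^ r i < n ^ R)%N.
Proof.
move=> Bn rR; have n0 : (0 < n)%N by apply: leq_ltn_trans Bn.
case: R rR => [|R] rR.
  by rewrite big1 ?muln0 // => i /rR.
apply: (@leq_ltn_trans (B * (#|I| * n ^ R))).
  rewrite leq_mul2l; apply/orP; right.
  apply: (@leq_trans (\sum_(i in P) n ^ R)).
    by apply: leq_sum => i /rR; rewrite ltnS; apply: leq_pexp2l.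
  by rewrite sum_nat_const leq_mul2r max_card orbT.
by rewrite mulnA expnS ltn_pmul2r // expn_gt0 n0.
Qed.

(* The weights are n ^ R + n ^ r e with distinct exponents r e < R, smaller on C
   than off C; each u excludes the roots n of one nonzero polynomial. *)
Lemma generic_weights (E : finType) (C : {set E}) (B : nat)
    (us : seq {ffun E -> rat}) : 0 \notin us ->
  exists (L : nat) (kappa : E -> nat),
  [/\ forall u, u \in us -> \sum_e u e * (L + kappa e)%:R != 0,
      (B * \sum_e kappa e < L)%N &
      forall e, e \notin C -> (B * \sum_(f in C) kappa f < kappa e)%N].
Proof.
(* The shift by [#|E|] puts every exponent off [C] above all those on [C]. *)
move=> us0; pose r (e : E) := (enum_rank e + (e \notin C) * #|E|)%N.
pose R := (#|E| + #|E|)%N.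
have rR e : (r e < R)%N.
  by rewrite /r /R -addSn leq_add // -[leqRHS]mul1n leq_mul2r leq_b1 orbT.
have rC e : e \in C -> (r e < #|E|)%N by move=> eC; rewrite /r eC addn0.
have rnC e : e \notin C -> (#|E| <= r e)%N.
  by move=> eC; rewrite /r eC mul1n leq_addl.
have r_inj : injective r.
  move=> e f h; apply: enum_rank_inj; apply: val_inj => /=.
  move: (h); rewrite /r; case: (boolP (e \in C)); case: (boolP (f \in C)) => fC eC.
  - by rewrite !addn0.
  - by have := rC e eC; rewrite h ltnNge rnC.
  - by have := rC f fC; rewrite -h ltnNge rnC.
  - by move/addIn.
(* The value of [p u] at n is the sum to be kept nonzero. Its coefficient at [r e] is [u e], the
   exponents being distinct and below [R]. *)
pose p (u : {ffun E -> rat}) : {poly rat} := \sum_e u e *: ('X^R + 'X^(r e)).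
have p0 u : u != 0 -> p u != 0.
  move=> u0; apply: contraNneq u0 => pu; apply/eqP.
  have cR : \sum_e u e = 0.
    have : (p u)`_R = 0 by rewrite pu coef0.
    rewrite /p coef_sum => h; rewrite -[RHS]h; apply: eq_bigr => e _.
    by rewrite coefZ coefD !coefXn eqxx eq_sym ltn_eqF // addr0 mulr1.
  apply/ffunP=> e; rewrite [RHS]ffunE.
  have : (p u)`_(r e) = 0 by rewrite pu coef0.
  rewrite /p coef_sum (bigD1 e) //= big1 => [|f ne].
    by rewrite coefZ coefD !coefXn eqxx ltn_eqF // add0r mulr1 addr0.
  rewrite coefZ coefD !coefXn ltn_eqF // add0r; case: eqP => [/r_inj h|].
    by rewrite h eqxx in ne.
  by rewrite mulr0.
have q0 : \prod_(u <- us) p u != 0.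
  rewrite prodf_seq_neq0; apply/allP => u uus /=; apply: p0.
  by apply: contraNneq us0 => <-.
have [n [nB nq]] := poly_nonroot_ge (B * #|E|).+1 q0.
exists (n ^ R)%N, (fun e => n ^ r e)%N; split.
- move=> u uus; move: nq; rewrite horner_prod prodf_seq_neq0 => /allP /(_ u uus) /=.
  rewrite /p horner_sum; congr (_ != _); apply: eq_bigr => e _.
  by rewrite hornerZ hornerD !hornerXn natrD !natrX.
- by apply: sum_expn_lt.
- move=> e eC; apply: (@leq_trans (n ^ #|E|)).
    by apply: sum_expn_lt => // f /rC.
  by rewrite leq_pexp2l ?rnC // (leq_ltn_trans _ nB).
Qed.

(** The rows of [a] in [F], cut down to the columns [S], outnumber these columns and so are linearly
    dependent; the relation is extended by 0. *)
Lemma exists_kernel_vector (E T : finType) (a : E -> T -> nat) (F : {set E})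
    (S : {set T}) : (#|S| < #|F|)%N ->
  exists u : {ffun E -> rat}, [/\ u != 0, forall e, u e != 0 -> e \in F &
    forall v, v \in S -> \sum_e u e * (a e v)%:R = 0].
Proof.
move=> SF; pose M : 'M[rat]_(#|F|, #|S|) :=
  \matrix_(i, j) (a (enum_val i) (enum_val j))%:R.
have kM : kermx M != 0.
  rewrite kermx_eq0 /row_free; apply: contraTneq (rank_leq_col M) => ->.
  by rewrite -ltnNge.
pose w := nz_row (kermx M).
have w0 : w != 0 by rewrite nz_row_eq0.
have /sub_kermxP wM : (w <= kermx M)%MS by apply: nz_row_sub.
have [e0 e0F] : exists e0, e0 \in F by apply/card_gt0P; apply: leq_ltn_trans SF.
pose u : {ffun E -> rat} :=
  [ffun e => if e \in F then w 0 (enum_rank_in e0F e) else 0].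
have uE i : u (enum_val i) = w 0 i by rewrite ffunE enum_valP enum_valK_in.
exists u; split.
- apply: contraNneq w0 => u0; apply/eqP/rowP=> i.
  by rewrite mxE -uE u0 ffunE.
- by move=> e; rewrite ffunE; case: ifP => //; rewrite eqxx.
- move=> v vS; rewrite (bigID (mem F)) /= [X in _ + X]big1 => [|e /negbTE eF].
    rewrite addr0 big_enum_val /=.
    have := congr1 (fun A : 'rV_#|S| => A 0 (enum_rank_in vS v)) wM.
    rewrite !mxE => h; rewrite -[RHS]h; apply: eq_bigr => i _.
    by rewrite mxE uE enum_rankK_in.
  by rewrite ffunE eF mul0r.
Qed.

(** * The filtration by optimal flows *)

(** The interface between flows and homology: [val] will be the cost of an optimal flow and [sig]
    its support. Fibres of [val] on small sets are closed under union, and [sig F] is their common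
    lower end. *)
Record interval_filtration (E : finType) (small : {set E} -> Prop)
    (EG C : {set E}) (d : nat) (val : {set E} -> nat)
    (sig : {set E} -> {set E}) : Prop := {
  val_mono : forall F F' : {set E}, F \subset F' -> (val F <= val F')%N;
  sig_sub : forall F, sig F \subset F;
  card_sig : forall F, small F -> (#|sig F| <= d)%N;
  val_interval : forall F F' : {set E},
    sig F \subset F' -> F' \subset F -> val F' = val F;
  fibre_union : forall F F', small F -> small F' -> val F = val F' ->
    [/\ sig F = sig F', small (F :|: F') & val (F :|: F') = val F];
  fibre_single : forall F e, small F -> F \subset C -> sig F = F ->
    #|F| = d -> e \in EG -> e \notin C -> val (e |: F) != val F
}.

Section Filtration.
Variables (E T : finType) (A : {set T}) (ea eb : E -> T) (EG : {set E}).
Hypothesis EGP : bipartition A ea eb EG.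
Variables (C : {set E}) (k : nat).

Local Notation load := (load ea eb).
Local Notation feasible := (feasible ea eb).
Local Notation optimal := (optimal ea eb).
Local Notation dual := (dual ea eb).

Definition few_disjoint (F : {set E}) : Prop :=
  F \subset EG /\ matching_le ea eb k F.

(** Larger than [#|T|], which makes the dual unique, and larger than k, so that k + 1 disjoint edges
    with N units each exceed k (N + 1). *)
Let N := (#|T| + k).+1.
Let w (v : T) : nat := if v \in A then N.+1 else N.

Let w_le v : (w v <= N.+1)%N. Proof. by rewrite /w; case: ifP. Qed.
Let w_gt0 v : (0 < w v)%N. Proof. by rewrite /w; case: ifP. Qed.

Lemma feasible_sub w' (F F' : {set E}) x :
  F \subset F' -> feasible w' F x -> feasible w' F' x.
Proof. by move=> /subsetP s [xF xw]; split=> // e /xF /s. Qed.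

Lemma total_few_disjoint F x : few_disjoint F -> feasible w F x ->
  (total x <= k * N.+1)%N.
Proof.
move=> [FG mF] fx; have [S [cS Sk]] := koenig EGP FG mF.
apply: leq_trans (total_le_cover fx cS) _.
apply: (@leq_trans (\sum_(v in S) N.+1)); first exact: leq_sum.
by rewrite sum_nat_const leq_mul2r Sk orbT.
Qed.

(* A level set of y - y' consists of saturated vertices and meets both sides in
   sets carrying the same flow: (N + 1) p = N q with p <= #|T| < N. *)
Lemma dual_unique c (F F' : {set E}) x y y' : F \subset EG ->
  feasible w F x -> dual w c F x y -> dual w c F' x y' -> y =1 y'.
Proof.
move=> FG [xF xw] [_ d2 d3] [_ d2' d3'] v; apply/eqP; apply: contraT => neq.
pose D u : int := (y u)%:Z - (y' u)%:Z.
pose delta : int := if v \in A then D v else - D v.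
(* Both duals are tight on edges carrying flow, so y - y' takes opposite values at their ends, and
   [S] contains both ends or none. *)
pose S := [set u | D u == (if u \in A then delta else - delta)].
have vS : v \in S.
  rewrite inE /delta; case: (v \in A); first exact: eqxx.
  by rewrite opprK; apply: eqxx.
have d0 : delta != 0.
  have : D v != 0 by rewrite subr_eq0 eqz_nat.
  by rewrite /delta; case: ifP => _; rewrite ?oppr_eq0.
have sat u : u \in S -> load x u = w u.
  rewrite inE => /eqP Du; apply/eqP; rewrite eqn_leq xw /= leqNgt.
  apply/negP=> lt; move: Du; rewrite /D d3 // d3' // subrr => /esym/eqP.
  by case: ifP => _; rewrite ?oppr_eq0 (negbTE d0).
have sides e : x e != 0%N ->
    ((ea e \in S :&: A) + (eb e \in S :&: A) =
     (ea e \in S :\: A) + (eb e \in S :\: A))%N.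
  move=> xe; have eG : e \in EG by apply: (subsetP FG); apply: xF.
  rewrite !inE (eaA EGP eG) (ebA EGP eG) /= !(andbF, andbT).
  rewrite addn0 add0n; congr nat_of_bool.
  have : D (ea e) = - D (eb e).
    have := d2 e xe; rewrite d2' // => /(congr1 Posz); rewrite !PoszD => h.
    by apply/eqP; rewrite /D opprB subr_eq addrAC eq_sym subr_eq addrC h addrC.
  by move=> ->; rewrite eqr_oppLR.
have loads (Q : {set T}) : Q \subset S -> (\sum_e ((ea e \in Q) + (eb e \in Q)) * x e = \sum_(u in Q) w u)%N.
  move=> /subsetP QS; rewrite -(weighted_load ea eb (fun v => v \in Q)).
  rewrite (bigID (mem Q)) /= [X in (_ + X)%N]big1 ?addn0 => [|u /negbTE -> //].
  by apply: eq_bigr => u uQ; rewrite uQ mul1n sat ?QS.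
have eqs : (#|S :&: A| * N.+1 = #|S :\: A| * N)%N.
  rewrite -!sum_nat_const.
  transitivity (\sum_(u in S :&: A) w u)%N.
    by apply: eq_bigr => u; rewrite inE /w => /andP[_ ->].
  transitivity (\sum_(u in S :\: A) w u)%N; last first.
    by apply: eq_bigr => u; rewrite inE /w => /andP[/negbTE ->].
  rewrite -!loads ?subsetIl ?subsetDl //; apply: eq_bigr => e _.
  by have [-> | /sides ->] := eqVneq (x e) 0%N; rewrite ?muln0.
have pT : (#|S :&: A| < N)%N by rewrite ltnS (leq_trans (max_card _)) ?leq_addr.
have : (0 < #|S :&: A| + #|S :\: A|)%N.
  by rewrite cardsID (cardD1 v) vS.
move: eqs pT; move: #|_| #|_| => q p; rewrite mulnS => eqs pN pq.
have [qp | pq'] := leqP q p.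
  have : (p + p * N <= p * N)%N by rewrite eqs leq_mul2r qp orbT.
  rewrite -[leqRHS]add0n leq_add2r leqn0 => /eqP p0.
  by move: qp pq; rewrite p0 leqn0 => /eqP ->.
have : (p.+1 * N <= q * N)%N by rewrite leq_mul2r pq' orbT.
by rewrite -eqs mulSn leq_add2r leqNgt pN.
Qed.

(** * The filtration obtained from generic weights *)

Section Weights.
Variables (L : nat) (kappa : E -> nat).
Let c e := (L + kappa e)%N.
(** What generic weights provide: total flow dominates the cost, one unit off [C] outweighs in
    [kappa] any flow on [C], a flow is determined by its cost, and edges tight for a dual are
    independent. *)
Hypothesis L_big : (N.+1 * \sum_e kappa e < L)%N.
Hypothesis kappa_C :
  forall e, e \notin C -> (N.+1 * \sum_(f in C) kappa f < kappa e)%N.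
Hypothesis cost_inj : forall F F' x x', feasible w F x -> feasible w F' x' ->
  cost c x = cost c x' -> x = x'.
Hypothesis rank_le : forall (F : {set E}) (S : {set T}) (y : T -> nat),
  (forall e, e \in F -> c e = (y (ea e) + y (eb e))%N) ->
  (forall v, v \notin S -> y v = 0%N) -> (#|F| <= #|S|)%N.

Lemma costE (x : E -> nat) : cost c x = (L * total x + cost kappa x)%N.
Proof.
rewrite /cost /total big_distrr -big_split /=; apply: eq_bigr => e _.
by rewrite mulnDl.
Qed.

Lemma cost_kappa_le F x (Q : {set E}) : feasible w F x -> F \subset Q ->
  (cost kappa x <= N.+1 * \sum_(e in Q) kappa e)%N.
Proof.
move=> fx FQ; rewrite /cost (bigID (mem Q)) /= [X in (_ + X)%N]big1 => [|e eQ].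
  rewrite addn0 big_distrr /=; apply: leq_sum => e _.
  by rewrite mulnC leq_mul2r (leq_trans (feasible_le e fx)) ?orbT.
have [-> | xe] := eqVneq (x e) 0%N; first by rewrite muln0.
by case: fx => /(_ e xe) /(subsetP FQ); rewrite (negbTE eQ).
Qed.

Lemma total_lt_cost F x x' : feasible w F x -> (total x < total x')%N ->
  (cost c x < cost c x')%N.
Proof.
move=> fx lt; rewrite !costE; apply: (@leq_trans (L * total x + L)).
  rewrite -addnS leq_add2l; apply: leq_ltn_trans L_big.
  have := cost_kappa_le fx (subsetT F).
  by under eq_bigl do rewrite inE.
by rewrite -mulnSr (leq_trans _ (leq_addr _ _)) // leq_mul2l lt orbT.
Qed.

(** N units per edge fit every capacity. On k + 1 disjoint edges their total exceeds the bound of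
    [total_few_disjoint]. *)
Lemma matching_flow (F M : {set E}) : F \subset EG -> M \subset F ->
  {in M &, injective ea} -> {in M &, injective eb} ->
  feasible w F [ffun e => if e \in M then N else 0%N].
Proof.
move=> FG MF injA injB; split=> [e|v].
  by rewrite ffunE; case: ifP => // eM _; apply: (subsetP MF).
have MG e : e \in M -> e \in EG by move=> eM; apply/(subsetP FG)/(subsetP MF).
have Nw : (N <= w v)%N by rewrite /w; case: ifP.
rewrite /load (bigID (mem M)) /= [X in (_ + X)%N]big1 => [|e]; last first.
  by rewrite ffunE => /negbTE ->.
rewrite addn0; have [e /andP[eM ev] | no] := pickP (fun e => (e \in M) && (incid ea eb e v != 0%N)); last first.
  rewrite big1 // => e eM; have := no e; rewrite eM /= => /negbFE /eqP ->.
  by rewrite muln0.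
rewrite (bigD1 e) //= big1 => [|f /andP[fM ne]].
  rewrite addn0 ffunE eM (incidE EGP) ?MG // -[leqRHS]muln1 leq_mul //.
  by case: ifP => _; apply: leq_b1.
move: ev; rewrite ffunE fM !(incidE EGP) ?MG //.
case: ifP => _; rewrite eqb0 negbK => /eqP <-; case: eqP => [h|_]; rewrite ?muln0 //.
  by rewrite (injA _ _ fM eM h) eqxx in ne.
by rewrite (injB _ _ fM eM h) eqxx in ne.
Qed.

(** By [dual_unique] both sets have the same dual, which certifies [x] on the union. A matching of k
    + 1 edges there would carry more flow than [x]. *)
Lemma optimal_union F F' x : few_disjoint F -> few_disjoint F' ->
  optimal w c F x -> optimal w c F' x ->
  few_disjoint (F :|: F') /\ optimal w c (F :|: F') x.
Proof.
move=> fF fF' oF oF'; have [FG _] := fF; have [FG' _] := fF'.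
have [y dy] := optimal_dual EGP FG oF; have [y' dy'] := optimal_dual EGP FG' oF'.
have yy' := dual_unique FG oF.1 dy dy'.
have oU : optimal w c (F :|: F') x.
  apply: (@dual_optimal _ _ _ _ _ _ _ _ y); first exact: feasible_sub (subsetUl F F') oF.1.
  case: dy => d1 d2 d3; split=> // e; rewrite inE => /orP[/d1 // | eF'].
  by rewrite !yy'; case: dy' => h _ _; apply: h.
split=> //; have UG : F :|: F' \subset EG by rewrite subUset FG.
split=> // M MF injA injB; rewrite leqNgt; apply/negP => kM.
have := oU.2 _ (matching_flow UG MF injA injB); rewrite leqNgt => /negP; apply.
apply: total_lt_cost oF.1 _; apply: leq_ltn_trans (total_few_disjoint fF oF.1) _.
rewrite /total (bigID (mem M)) /= (leq_trans _ (leq_addr _ _)) //.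
under eq_bigr => e eM do rewrite ffunE eM.
rewrite sum_nat_const; apply: (@leq_trans (k.+1 * N)); last first.
  by rewrite leq_mul2r kM orbT.
by rewrite mulnS mulSn ltn_add2r ltnS leq_addl.
Qed.

Definition tight x : {set T} := [set v | load x v == w v].

(** Tight vertices carry N + 1 units on the left and N on the right, out of at most k (N + 1) < (k +
    1) N. The left bound keeps the total for the equality case. *)
Lemma tight_card F x : few_disjoint F -> feasible w F x ->
  (#|tight x :&: A| * N.+1 <= total x)%N /\ (#|tight x :\: A| <= k)%N.
Proof.
move=> fF fx; have [FG _] := fF; have [xF _] := fx.
have part (P Q : {set T}) n : P \subset Q -> (forall v, v \in P -> load x v = n) ->
    (#|P| * n <= \sum_(v in Q) load x v)%N.
  move=> /setIidPr PQ nP; rewrite [leqRHS](big_setID P) /= PQ.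
  by rewrite (eq_bigr (fun=> n)) // sum_nat_const leq_addr.
split.
  rewrite (total_left EGP FG xF); apply: part; first exact: subsetIr.
  by move=> v; rewrite !inE /w => /andP[/eqP -> ->].
rewrite -ltnS -(@ltn_pmul2r N) //.
apply: (@leq_ltn_trans (k * N.+1)); last by rewrite mulnS mulSn ltn_add2r ltnS leq_addl.
apply: leq_trans (total_few_disjoint fF fx).
rewrite (total_right EGP FG xF); apply: part.
  by apply/subsetP=> v; rewrite !inE => /andP[].
by move=> v; rewrite !inE /w => /andP[/negbTE h /eqP ->]; rewrite h.
Qed.

(** Edges with flow are tight for a dual that vanishes at unsaturated vertices, so [rank_le]
    applies. *)
Lemma support_le_tight (F : {set E}) x : F \subset EG -> optimal w c F x ->
  (#|[set e | x e != 0%N]| <= #|tight x|)%N.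
Proof.
move=> FG ox; have [y [d1 d2 d3]] := optimal_dual EGP FG ox.
apply: (rank_le (y := y)) => [e | v]; first by rewrite inE => /d2.
by rewrite inE neq_ltn => /orP[/d3 // | ]; rewrite ltnNge ox.1.2.
Qed.

(* A saturated left side of size k makes every cover cost at least k (N + 1), and
   only the covers avoiding eb e may attain this; so lowering the two capacities
   at e costs at most one unit of flow, which e can carry instead. *)
Lemma not_optimal_off (F : {set E}) (x : {ffun E -> nat}) e : few_disjoint F -> F \subset C ->
  (k * N.+1 <= total x)%N -> e \in EG -> e \notin C -> feasible w F x ->
  ~ optimal w c (e |: F) x.
Proof.
move=> fF FC kx eG eC fx [_ mx]; have [FG _] := fF.
have totx : total x = (k * N.+1)%N.
  by apply/eqP; rewrite eqn_leq kx (total_few_disjoint fF fx).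
pose w' v := (w v - incid ea eb e v)%N.
have [x0 ox0] := exists_optimal ea eb w' (fun=> 1%N) F.
have [y dy] := optimal_dual EGP FG ox0; have [d1 _ _] := dy.
have [x0F x0w] := ox0.1.
have inc1 v : (incid ea eb e v <= 1)%N.
  by rewrite (incidE EGP v eG); case: ifP => _; apply: leq_b1.
pose V := [set v | y v != 0%N].
have cV : covers ea eb V F.
  by move=> f /d1; rewrite !inE -!lt0n -addn_gt0; apply: leq_trans.
have sumw : (\sum_(v in V) w v = #|V :&: A| * N.+1 + #|V :\: A| * N)%N.
  rewrite (big_setID A) /= -!sum_nat_const; congr (_ + _)%N.
    by apply: eq_bigr => v; rewrite inE /w => /andP[_ ->].
  by apply: eq_bigr => v; rewrite inE /w => /andP[/negbTE ->].
have x0V : (\sum_(v in V) w' v <= total x0)%N.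
  rewrite -cost1 (dual_cost ox0.1 dy) [leqRHS](bigID (mem V)) /=.
  rewrite (leq_trans _ (leq_addr _ _)) //; apply: leq_sum => v.
  by rewrite inE -lt0n => yv; rewrite leq_pmulr.
have wV : (\sum_(v in V) w v <= \sum_(v in V) w' v + ((ea e \in V) + (eb e \in V)))%N.
  have -> : ((ea e \in V) + (eb e \in V) = \sum_(v in V) incid ea eb e v)%N.
    rewrite -(sum_incid ea eb (fun v => v \in V)) (bigID (mem V)) /=.
    rewrite [X in (_ + X)%N]big1 ?addn0 => [|v /negbTE -> //].
    by apply: eq_bigr => v ->; rewrite mul1n.
  by rewrite -big_split /=; apply: leq_sum => v _; rewrite addnC -leq_subLR.
have kx0 : (k * N.+1 <= total x0 + 1)%N.
  have kV : (k * N.+1 <= \sum_(v in V) w v)%N.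
    by rewrite -totx; apply: total_le_cover fx cV.
  (* A cover costing more than k (N + 1) loses at most two units under [w']; one costing exactly
     that much avoids [eb e] and loses at most one. *)
  have [big | small] := ltnP (k * N.+1) (\sum_(v in V) w v)%N.
    have : (k * N.+1 < total x0 + 2)%N.
      apply: (leq_trans big); apply: (leq_trans wV).
      by rewrite leq_add // -(addn1 1) leq_add ?leq_b1.
    by rewrite addn2 ltnS addn1.
  have eq : (\sum_(v in V) w v = k * N.+1)%N by apply/eqP; rewrite eqn_leq small.
  rewrite -eq; apply: (leq_trans wV); apply: leq_add => //.
  suff -> : (eb e \in V) = false by rewrite addn0 leq_b1.
  apply/negP => ebV.
  have : (0 < #|V :\: A|)%N.
    by apply/card_gt0P; exists (eb e); rewrite inE ebV (ebA EGP).
  move: eq; rewrite sumw.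
  have : (k < N)%N by rewrite /N ltnS leq_addl.
  (* For k < N, the equation p (N + 1) + q N = k (N + 1) has no solution with q > 0. *)
  move: #|V :&: A| #|V :\: A| N; clear => p q n kn + q0.
  have [kp | pk] := leqP k p.
    apply/eqP; rewrite gtn_eqF //; apply: (@leq_ltn_trans (p * n.+1)).
      by rewrite leq_mul2r kp orbT.
    by rewrite -[ltnLHS]addn0 ltn_add2l muln_gt0 q0 (leq_ltn_trans _ kn).
  rewrite !mulnS => eq.
  have [qle | qgt] := leqP (p + q) k.
    have : (p * n + q * n <= k * n)%N by rewrite -mulnDl leq_mul2r qle orbT.
    by have := eq; nia.
  nia.
pose x1 := [ffun f => x0 f + (f == e)]%N.
have load1 v : load x1 v = (load x0 v + incid ea eb e v)%N.
  transitivity (\sum_f (x0 f * incid ea eb f v + (f == e) * incid ea eb f v))%N.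
    by apply: eq_bigr => f _; rewrite ffunE mulnDl.
  rewrite big_split /=; congr (_ + _)%N.
  by rewrite (bigD1 e) //= eqxx mul1n big1 ?addn0 // => f /negbTE ->.
have tot1 : total x1 = (total x0 + 1)%N.
  rewrite /total; under eq_bigr do rewrite ffunE.
  rewrite big_split /=; congr (_ + _)%N.
  by rewrite (bigD1 e) //= eqxx big1 ?addn0 // => f /negbTE ->.
have f1 : feasible w (e |: F) x1.
  split=> [f | v].
    rewrite ffunE !inE; case: (f =P e) => //= _; rewrite addn0; exact: x0F.
  rewrite load1 -(subnK (leq_trans (inc1 v) (w_gt0 v))) leq_add2r; exact: x0w.
have := mx _ f1; rewrite leqNgt => /negP; apply.
(* [x1] carries at least as much flow as [x], and the unit added on [e] outweighs the whole [kappa]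
   cost of [x], which lives on [C]. *)
rewrite !costE totx tot1; apply: (@leq_trans (L * (total x0 + 1) + cost kappa x1)) => //.
apply: (@leq_ltn_trans (L * (total x0 + 1) + cost kappa x)).
  by rewrite leq_add2r leq_mul2l kx0 orbT.
rewrite ltn_add2l; apply: (leq_ltn_trans (cost_kappa_le fx FC)).
apply: (leq_trans (kappa_C eC)).
rewrite /cost (bigD1 e) //= ffunE eqxx addn1 (leq_trans _ (leq_addr _ _)) //.
exact: leq_pmulr.
Qed.

(** By [cost_inj] the optimal flow, hence its support, is a function of the optimal cost. *)
Lemma filtration_of_weights :
  exists val sig, interval_filtration few_disjoint EG C (2 * k) val sig.
Proof.
have [xs xsP] := fin_all_exists (fun F => exists_optimal ea eb w c F).
pose val F := cost c (xs F); pose sig F := [set e | xs F e != 0%N].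
have fxs F : feasible w F (xs F) := (xsP F).1.
have valE F F' : val F = val F' -> xs F = xs F'.
  exact: cost_inj (fxs F) (fxs F').
have mono (F F' : {set E}) : F \subset F' -> (val F <= val F')%N.
  by move=> s; apply: (xsP F').2; apply: feasible_sub (fxs F).
(* A support of size 2 k forces k tight vertices on the left, hence the k (N + 1) units of flow
   required by [not_optimal_off]. *)
have card2 F : few_disjoint F -> (#|sig F| <= 2 * k)%N /\
    (#|sig F| = 2 * k -> k * N.+1 <= total (xs F))%N.
  move=> fF; have [FG _] := fF.
  have [hA hB] := tight_card fF (fxs F).
  have := support_le_tight FG (xsP F); rewrite -(cardsID A (tight (xs F))) => h.
  have hA' : (#|tight (xs F) :&: A| <= k)%N.
    by rewrite -(@leq_pmul2r N.+1) // (leq_trans hA) // (total_few_disjoint fF).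
  split; first by rewrite (leq_trans h) // mul2n -addnn leq_add.
  move=> eq; apply: leq_trans hA; rewrite leq_mul2r /=.
  by move: h; rewrite eq mul2n -addnn => h; rewrite -(leq_add2r k) (leq_trans h) // leq_add2l.
exists val, sig; split=> //.
- by move=> F; apply/subsetP=> e; rewrite inE; apply: (fxs F).1.
- by move=> F /card2[].
- move=> F F' sF' F'F; apply/eqP; rewrite eqn_leq mono //=.
  apply: (xsP F').2; split; last exact: (fxs F).2.
  by move=> e xe; apply: (subsetP sF'); rewrite inE.
- move=> F F' fF fF' eq; have xE := valE _ _ eq.
  have oF' : optimal w c F' (xs F) by rewrite xE; apply: xsP.
  have [fU oU] := optimal_union fF fF' (xsP F) oF'.
  split=> //; first by rewrite /sig xE.
  apply/eqP; rewrite eqn_leq [X in _ && X]mono ?subsetUl // andbT.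
  exact: (oU.2 _ (fxs (F :|: F'))).
- move=> F e fF FC sF cF eG eC; apply/negP => /eqP eq.
  have [_ h] := card2 F fF.
  apply: (not_optimal_off fF FC _ eG eC (fxs F)); first by apply: h; rewrite sF.
  by rewrite -(valE _ _ eq); apply: xsP.
Qed.

End Weights.

Lemma exists_filtration :
  exists val sig, interval_filtration few_disjoint EG C (2 * k) val sig.
Proof.
pose fl := {ffun E -> 'I_N.+2}.
pose diff (p : fl * fl) : {ffun E -> rat} :=
  [ffun e => (p.1 e : nat)%:R - (p.2 e : nat)%:R].
have kv (p : {set E} * {set T}) : exists u : {ffun E -> rat},
    (#|p.2| < #|p.1|)%N -> [/\ u != 0, forall e, u e != 0 -> e \in p.1 &
    forall v, v \in p.2 -> \sum_e u e * (incid ea eb e v)%:R = 0].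
  have [lt | _] := ltnP #|p.2| #|p.1|; last by exists 0.
  by have [u uP] := exists_kernel_vector (incid ea eb) lt; exists u.
have [ker kerP] := fin_all_exists kv.
(* Avoiding differences of bounded flows makes the cost injective on flows; avoiding one kernel
   vector for each pair with [#|S| < #|F|] gives the rank bound. *)
pose us := [seq u <- codom diff ++ codom ker | u != 0].
have us0 : 0 \notin us by rewrite mem_filter eqxx.
have [L [kappa [gen L_big kappa_C]]] := generic_weights C N.+1 us0.
apply: (filtration_of_weights L_big kappa_C).
- move=> F F' x x' fx fx' eq.
  have bnd F0 x0 : feasible w F0 x0 -> forall e, (x0 e < N.+2)%N.
    by move=> f0 e; rewrite ltnS (leq_trans (feasible_le e f0)).
  pose o F0 x0 (f0 : feasible w F0 x0) : fl := [ffun e => Ordinal (bnd F0 x0 f0 e)].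
  pose p := (o _ _ fx, o _ _ fx').
  have pE e : diff p e = (x e)%:R - (x' e)%:R by rewrite !ffunE.
  have [d0 | dn0] := eqVneq (diff p) 0.
    apply/ffunP=> e; have := pE e; rewrite d0 ffunE => /eqP.
    by rewrite eq_sym subr_eq0 eqr_nat => /eqP.
  have : diff p \in us by rewrite mem_filter dn0 mem_cat codom_f.
  move/gen/eqP; case.
  under eq_bigr => e _ do rewrite pE mulrBl -!natrM.
  rewrite sumrB -!natr_sum; apply/eqP; rewrite subr_eq0 eqr_nat; apply/eqP.
  transitivity (cost (fun e => L + kappa e)%N x).
    by apply: eq_bigr => e _; rewrite mulnC.
  by rewrite eq; apply: eq_bigr => e _; rewrite mulnC.
- move=> F S y tF tS; rewrite leqNgt; apply/negP => lt.
  have [un0 uF uS] := kerP (F, S) lt.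
  have : ker (F, S) \in us by rewrite mem_filter un0 mem_cat codom_f orbT.
  move/gen/eqP; case; set u := ker (F, S) in un0 uF uS *.
  (* On the support of [u] costs are sums of [y] over ends, so the pairing with [u] reduces to
     incidence sums that vanish on [S]. *)
  transitivity (\sum_v (y v)%:R * \sum_e u e * (incid ea eb e v)%:R).
    under [RHS]eq_bigr => v _ do rewrite big_distrr /=.
    rewrite exchange_big /=; apply: eq_bigr => e _.
    under eq_bigr => v _ do rewrite mulrCA -natrM.
    rewrite -big_distrr -natr_sum sum_incid /=.
    by have [-> | /uF /tF ->] := eqVneq (u e) 0; rewrite ?mul0r.
  rewrite big1 // => v _; have [vS | vS] := boolP (v \in S).
    by rewrite uS ?mulr0.
  by rewrite tS ?mul0r.
Qed.

End Filtration.

(** * Simplicial chains *)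

Section ChainCalculus.
Variables (K : fieldType) (E : finType).
Local Notation chain := (chain K E).
Implicit Types (c : chain) (F G : {set E}) (D : scomplex E) (e f : E).

Local Notation sg F e := ((-1) ^+ position F e : K).

Lemma boundaryE c G :
  boundary K E c G = \sum_(e | e \notin G) sg G e * c (e |: G).
Proof.
have scE (a : K) (b : K^o) : a *: b = a * b by [].
rewrite lfunE /= /boundary_fun sum_ffunE.
transitivity (\sum_(F : {set E}) \sum_(e in F)
    if (e \notin G) && (F == e |: G) then sg G e * c (e |: G) else 0).
  apply: eq_bigr => F _; rewrite ffunE sum_ffunE scaler_sumr.
  apply: eq_bigr => e eF; rewrite !ffunE [_ *: (_ : K^o)]scE [X in _ * X]scE.
  have -> : (G == F :\ e) = (e \notin G) && (F == e |: G).
    apply/eqP/andP => [-> | [eG /eqP ->]]; last by rewrite setU1K.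
    by rewrite setD11 setD1K.
  case: ifP => [/andP[eG /eqP ->] | _]; last by rewrite !mulr0.
  rewrite mulr1 mulrC; congr (_ ^+ _ * _); apply: eq_card => x; rewrite !inE.
  by case: (x =P e) => [->|] //=; rewrite ltnn !andbF.
rewrite (exchange_big_dep xpredT) //= [RHS]big_mkcond; apply: eq_bigr => e _.
case: ifP => [eG | _]; last by rewrite big1.
rewrite (bigD1 (e |: G)) ?setU11 //= eqxx big1 ?addr0 // => F /andP[_ /negbTE ->].
by [].
Qed.

Lemma boundary_neq0 c G : boundary K E c G != 0 ->
  exists e, e \notin G /\ c (e |: G) != 0.
Proof.
rewrite boundaryE => h; have [e /andP[eG ce] | no] :=
    pickP (fun e => (e \notin G) && (c (e |: G) != 0)); first by exists e.
rewrite big1 ?eqxx // in h => e eG.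
by have := no e; rewrite eG => /negbFE /eqP ->; rewrite mulr0.
Qed.

(** Exterior multiplication by [e] on the left, a subset standing for the product of its elements in
    increasing order. *)
Definition wedge e c : chain :=
  [ffun G : {set E} => if e \in G then sg G e * c (G :\ e) else 0].

Lemma wedge_neq0 e c G : wedge e c G != 0 -> e \in G /\ c (G :\ e) != 0.
Proof.
rewrite ffunE; case: ifP => [eG | _]; last by rewrite eqxx.
by rewrite mulf_eq0 negb_or => /andP[].
Qed.

Lemma wedge_is_linear e : linear (wedge e).
Proof.
move=> a u v; apply/ffunP=> G; rewrite !ffunE; case: ifP => _.
  by rewrite mulrDr; congr (_ + _); apply: mulrCA.
by rewrite [_ *: _]mulr0 addr0.
Qed.

HB.instance Definition _ e :=
  GRing.isLinear.Build K chain chain _ (wedge e) (wedge_is_linear e).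

Lemma position_setD1 F e : position (F :\ e) e = position F e.
Proof.
apply: eq_card => x; rewrite !inE.
by case: (x =P e) => [->|] //=; rewrite ltnn !andbF.
Qed.

Lemma sgK F e : sg F e * sg F e = 1.
Proof. by rewrite -exprD addnn -mul2n exprM sqrrN !expr1n. Qed.

Lemma sg_swap F e f : e \in F -> f \in F -> e != f ->
  sg F e * sg (F :\ e) f = - (sg F f * sg (F :\ f) e).
Proof.
move=> eF fF; rewrite -(inj_eq enum_rank_inj) -(inj_eq val_inj) neq_ltn.
case/orP=> lt.
  by rewrite (position_D1_gt _ lt) (position_D1_lt eF lt) exprS mulN1r mulNr opprK mulrC.
by rewrite (position_D1_gt _ lt) (position_D1_lt fF lt) exprS mulN1r mulNr mulrC.
Qed.

Lemma wedge_anti e f c : wedge e (wedge f c) = - wedge f (wedge e c).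
Proof.
apply/ffunP=> G; rewrite !ffunE.
have [<- | ne] := eqVneq e f.
  by rewrite !setD11 !mulr0 !if_same oppr0.
rewrite !inE [f == e]eq_sym ne /=.
case: (boolP (e \in G)) => eG; case: (boolP (f \in G)) => fG; rewrite ?mulr0 ?oppr0 //.
rewrite !mulrA sg_swap // mulNr; congr (- (_ * c _)).
by rewrite !setDDl setUC.
Qed.

Lemma wedge_wedge e c : wedge e (wedge e c) = 0.
Proof.
by apply/ffunP=> G; rewrite !ffunE setD11 mulr0 if_same.
Qed.

(** The boundary is the antiderivation of the exterior algebra that sends every vertex to 1. *)
Lemma boundary_wedge e c :
  boundary K E (wedge e c) = c - wedge e (boundary K E c).
Proof.
apply/ffunP=> G; rewrite !ffunE boundaryE.
case: (boolP (e \in G)) => eG; last first.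
  rewrite subr0 (bigD1 e) //= big1 => [|f /andP[fG ne]].
    by rewrite addr0 ffunE setU11 -[position (e |: G) e]position_setD1 setU1K // mulrA sgK mul1r.
  by rewrite ffunE !inE eq_sym (negbTE ne) (negbTE eG) mulr0.
(* The term at [e] of the inner boundary cancels [c G]; the other terms match by [sg_swap]. *)
rewrite boundaryE [X in _ * X](bigD1 e) ?setD11 //= setD1K //.
rewrite mulrDr mulrA position_setD1 sgK mul1r opprD addNKr -mulrN -sumrN big_distrr.
apply: congr_big => // [f | f fG].
  by rewrite !inE negb_and negbK; case: (f =P e) => [-> | _]; rewrite ?eG ?andbT.
have ne : f != e by apply: contraNneq fG => ->.
rewrite ffunE inE eG orbT /= mulrN mulrA.
have -> : (f |: G) :\ e = f |: G :\ e.
  by apply/setP=> x; rewrite !inE; case: (x =P f) => [->|]; rewrite ?ne.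
have := @sg_swap (f |: G) f e; rewrite setU11 inE eG orbT => /(_ isT isT ne).
rewrite setU1K // => h.
have eHf : position (f |: G) f = position G f by rewrite -position_setD1 setU1K.
have eDf : position ((f |: G) :\ e) f = position (G :\ e) f.
  by rewrite -position_setD1 !setDDl [[set e; f]]setUC -setDDl setU1K.
rewrite eHf eDf in h; rewrite mulrA -mulNr; congr (_ * _).
move: h (sgK G e) (sgK (f |: G) e).
move: (sg G f) (sg G e) (sg (f |: G) e) (sg (G :\ e) f) => a b p q ab bb pp.
transitivity (a * b * (b * p)); first by rewrite -mulrA [b * (b * p)]mulrA bb mul1r.
rewrite ab mulNr; have -> : p * q * (b * p) = b * q * (p * p) by ring.
by rewrite pp mulr1.
Qed.


Lemma mem_chains D n c :
  reflect (forall F, c F != 0 -> F \in faces D /\ #|F| = n) (c \in chains K D n).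
Proof.
apply: (iffP idP) => [| supp].
  rewrite /chains; set X := image _ _ => cX F.
  rewrite (coord_span (X := in_tuple X) cX) sum_ffunE.
  have [i Xi | no] := pickP (fun i : 'I_(size X) => (X`_i : chain) F != 0); last first.
    rewrite big1 ?eqxx // => i _; have := no i => /negbFE /eqP.
    by rewrite ffunE => ->; rewrite scaler0.
  have /imageP[F' /[!inE] /andP[F'D /eqP F'n] XE] : X`_i \in X by apply: mem_nth.
  by move: Xi; rewrite XE ffunE; case: (F =P F') => [-> | _] //; rewrite eqxx.
have -> : c = \sum_F c F *: simplex K F.
  apply/ffunP=> F; rewrite sum_ffunE (bigD1 F) //= !ffunE eqxx.
  rewrite big1 ?addr0 => [|F' neF]; first by rewrite [_ *: _]mulr1.
  by rewrite !ffunE eq_sym (negPf neF) [_ *: _]mulr0.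
apply: rpred_sum => F _; have [-> | /supp[FD nF]] := eqVneq (c F) 0.
  by rewrite scale0r rpred0.
apply: rpredZ; apply: memv_span; apply/imageP; exists F => //.
by rewrite inE FD nF eqxx.
Qed.

Lemma boundary_chains D n c : c \in chains K D n.+1 ->
  boundary K E c \in chains K D n.
Proof.
move=> /mem_chains cD; apply/mem_chains => G /boundary_neq0[e [eG /cD[fD]]].
rewrite cardsU1 eG add1n => -[nG]; split=> //.
exact: faces_closedP fD (subsetU1 e G).
Qed.

(* Pushing the part of c of top value along wedge e, for an e which toggles that
   fibre of val, lowers the top value. *)
Lemma reduce_value D (val : {set E} -> nat) n m c :
  (forall F F', F \subset F' -> (val F <= val F')%N) ->
  (forall F, F \in faces D -> #|F| = n -> exists e, forall F',
     F' \in faces D -> val F' = val F ->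
     [/\ e |: F' \in faces D, val (e |: F') = val F & val (F' :\ e) = val F]) ->
  c \in chains K D n ->
  (forall G, boundary K E c G != 0 -> (val G < m)%N) ->
  exists c', [/\ c' \in chains K D n,
    c - c' \in (boundary K E @: chains K D n.+1)%VS &
    forall F, c' F != 0 -> (val F < m)%N].
Proof.
move=> mono toggle cD dc.
have [M cM] : exists M, forall F, c F != 0 -> (val F < M)%N.
  by exists (val setT).+1 => F _; rewrite ltnS mono ?subsetT.
elim: M c cD dc cM => [|M IH] c cD dc cM.
  by exists c; split=> //; [rewrite subrr rpred0 | move=> F /cM].
have [leMm | ltmM] := leqP M.+1 m.
  exists c; split=> //; first by rewrite subrr rpred0.
  by move=> F /cM h; apply: leq_trans leMm.
have [F0 /andP[cF0 /eqP F0M] | noM] := pickP (fun F => (c F != 0) && (val F == M)); last first.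
  apply: (IH c) => // F cF; have := cM F cF; rewrite ltnS leq_eqVlt.
  by have := noM F; rewrite cF /= => ->.
have [F0D F0n] := mem_chains _ _ _ cD F0 cF0.
have [e eP] := toggle F0 F0D F0n; rewrite F0M in eP.
pose p : chain := [ffun F => if val F == M then c F else 0].
have pE F : p F != 0 -> val F = M /\ c F != 0.
  by rewrite ffunE; case: (val F =P M) => // _; rewrite eqxx.
have qE F : (c - p) F != 0 -> (val F < M)%N.
  rewrite !ffunE; case: (val F =P M) => [_ | /eqP ne]; first by rewrite subrr eqxx.
  by rewrite subr0 => /cM; rewrite ltnS leq_eqVlt (negbTE ne).
have wD : wedge e p \in chains K D n.+1.
  apply/mem_chains => G /wedge_neq0[eG /pE[vG cG]].
  have [GD Gn] := mem_chains _ _ _ cD _ cG; have [] := eP _ GD vG.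
  by rewrite setD1K // => ? _ _; split=> //; rewrite (cardsD1 e) eG Gn.
pose c1 := c - boundary K E (wedge e p).
have c1D : c1 \in chains K D n by rewrite rpredB // boundary_chains.
have dc1 G : boundary K E c1 G != 0 -> (val G < m)%N.
  by rewrite linearB /= boundary_boundary subr0; apply: dc.
(* [c1] is (c - p) + wedge e (boundary p). If the second term had a face [F] of value M, then
   [F :\ e] would have value M too and lie in the boundary of [c], whose values are below m <= M. *)
have c1M F : c1 F != 0 -> (val F < M)%N.
  rewrite /c1 boundary_wedge opprB addrCA addrC => cF.
  have [wF0 | /wedge_neq0[eF dpF]] := eqVneq (wedge e (boundary K E p) F) 0.
    by apply: qE; move: cF; rewrite ffunE wF0 addr0.
  have [f [fF /pE[vH cH]]] := boundary_neq0 dpF.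
  set H := f |: F :\ e in vH cH.
  have [HD Hn] := mem_chains _ _ _ cD _ cH; have [eHD veH _] := eP _ HD vH.
  have FeH : F \subset e |: H by rewrite -(setD1K eF) setUS // subsetU1.
  have vF : (val F <= M)%N by rewrite -veH mono.
  rewrite ltn_neqAle vF andbT; apply/negP => /eqP FM.
  have [_ _ vFe] := eP _ (faces_closedP eHD FeH) FM.
  have : boundary K E c (F :\ e) != 0.
    have -> : c = p + (c - p) by rewrite addrCA subrr addr0.
    rewrite linearD ffunE.
    have [-> | /boundary_neq0[g [_ /qE]]] := eqVneq (boundary K E (c - p) (F :\ e)) 0.
      by rewrite addr0.
    by rewrite ltnNge -vFe mono // subsetU1.
  by move/dc; rewrite vFe ltnNge -ltnS ltmM.
have [c' [c'D cc' c'm]] := IH c1 c1D dc1 c1M.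
exists c'; split=> //.
rewrite (_ : c - c' = boundary K E (wedge e p) + (c1 - c')).
  by rewrite rpredD // memv_img.
by rewrite /c1 addrA addrCA subrr addr0.
Qed.

End ChainCalculus.

Section HomologyClasses.
Variables (K : fieldType) (E : finType).
Implicit Types D : scomplex E.

Lemma homology_class_eq0 D q (z : subvs_of (cycles K D q)) :
  (homology_class z == 0) = (vsval z \in boundaries K D q).
Proof. by rewrite vquot_eq0 -memv_preim lfunE. Qed.

Lemma homology_eq0 D q : (cycles K D q <= boundaries K D q)%VS ->
  forall h : homology K D q, h = 0.
Proof.
move=> /subvP zb h; rewrite -[h]vquot_reprK; apply/eqP.
by rewrite [_ == _]homology_class_eq0 zb ?subvsP.
Qed.

Lemma homology_neq0 D q z : z \in cycles K D q -> z \notin boundaries K D q ->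
  exists h : homology K D q, h != 0.
Proof. by move=> zc zb; exists (homology_class (Subvs zc)); rewrite homology_class_eq0. Qed.

Lemma homology_map_inj D D' q (sub : faces D \subset faces D') :
  (forall z, z \in cycles K D q -> z \in boundaries K D' q ->
    z \in boundaries K D q) -> injective (homology_map K q sub).
Proof.
move=> zb; apply: raddf_inj => h; rewrite -[h]vquot_reprK => /eqP h0.
apply/eqP; rewrite [_ == _]homology_class_eq0 zb ?subvsP //.
by move: h0; rewrite [X in X == _]homology_mapE homology_class_eq0.
Qed.

End HomologyClasses.

(** * Homology of filtered complexes *)

Section FilteredComplex.
Variables (K : fieldType) (E : finType) (small : {set E} -> Prop).
Variables (EG C : {set E}) (d : nat) (val : {set E} -> nat).
Variable sig : {set E} -> {set E}.
Hypothesis filt : interval_filtration small EG C d val sig.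
Variable D : scomplex E.
Hypothesis D_small : forall F, F \in faces D -> small F.
Hypothesis D_union : forall F F', F \in faces D -> F' \in faces D ->
  small (F :|: F') -> F :|: F' \in faces D.

(** An element of [F] outside [sig F] can be removed within the fibre, and added because the union
    with [F] stays in the fibre. *)
Lemma fibre_toggle F : F \in faces D -> (d < #|F|)%N ->
  exists e, forall F', F' \in faces D -> val F' = val F ->
    [/\ e |: F' \in faces D, val (e |: F') = val F & val (F' :\ e) = val F].
Proof.
move=> FD dF.
have [e eF eS] : exists2 e, e \in F & e \notin sig F.
  apply/subsetPn; apply: contraL dF => Fs; rewrite -leqNgt.
  by apply: leq_trans (card_sig filt (D_small FD)); apply: subset_leq_card.
exists e => F' F'D eq.
have [sE sU vU] := fibre_union filt (D_small FD) (D_small F'D) (esym eq).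
have eU : e |: F' \subset F :|: F' by rewrite setSU // sub1set.
split.
- exact: faces_closedP (D_union FD F'D sU) eU.
- apply/eqP; rewrite eqn_leq; apply/andP; split; [rewrite -vU | rewrite -eq];
    by apply: (val_mono filt) => //; apply: subsetU1.
- rewrite -eq; apply: (val_interval filt); last exact: subD1set.
  by rewrite -sE subsetD1 eS andbT sE; apply: (sig_sub filt).
Qed.

Lemma filtered_acyclic q : (d <= q)%N ->
  (cycles K D q <= boundaries K D q)%VS.
Proof.
move=> dq; apply/subvP => c; rewrite memv_cap memv_ker => /andP[cD /eqP dc].
(* With the bound 0 no face can remain. *)
have [] := @reduce_value K E D val q.+1 0 c (val_mono filt) _ cD.
- by move=> F FD nF; apply: fibre_toggle; rewrite ?nF.
- by move=> G; rewrite dc ffunE eqxx.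
- move=> c' [_ cc' c'0]; rewrite (_ : c = c - c') // (_ : c' = 0) ?subr0 //.
  by apply/ffunP=> F; rewrite ffunE; apply/eqP; apply: contraT => /c'0.
Qed.

Variable D0 : scomplex E.
Hypothesis D_EG : forall F, F \in faces D -> F \subset EG.
Hypothesis D0_sub : faces D0 \subset faces D.
Hypothesis D0_C : forall F, F \in faces D0 -> F \subset C.
Hypothesis D0_full : forall F, F \in faces D -> F \subset C -> F \in faces D0.
Hypothesis D0_dim : forall F, F \in faces D0 -> (#|F| <= d)%N.

(* A face F1 of top value in z is its own fibre: in D0 because D0 has no larger
   faces, and in D by fibre_single. A chain bounded by z can be pushed to values
   at most val F1, so it has no face above F1 left. *)
Lemma cycle_not_bounding q z : q.+1 = d -> z \in cycles K D0 q ->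
  z \in boundaries K D q -> z = 0.
Proof.
move=> qd; rewrite memv_cap memv_ker => /andP[zD0 /eqP dz] /memv_imgP[w wD zE].
apply/eqP; apply: contraT => zn0.
have [F0 zF0] : exists F0, z F0 != 0.
  apply/existsP; apply: contraT; rewrite negb_exists => /forallP z0.
  by case/eqP: zn0; apply/ffunP=> F; rewrite ffunE; have := z0 F; rewrite negbK => /eqP.
have [F1 zF1 maxF1] := arg_maxnP (P := fun F => z F != 0) val zF0.
have {}maxF1 F : z F != 0 -> (val F <= val F1)%N by move/maxF1.
have [F1D0 F1d] := mem_chains _ _ _ zD0 F1 zF1; rewrite qd in F1d.
have F1D : F1 \in faces D by apply: (subsetP D0_sub).
(* If [e] in [F1] is outside [sig F1], cancellation at [F1 :\ e] yields a second face [F2] of [z],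
   of the same value; then the union is a face of [D0] with more than d elements. *)
have sF1 : sig F1 = F1.
  apply/eqP; rewrite eqEsubset (sig_sub filt); apply/subsetPn => -[e eF1 es].
  have [f /andP[fF /andP[fe zf]] | no] := pickP (fun f =>
      [&& f \notin F1 :\ e, f != e & z (f |: F1 :\ e) != 0]); last first.
    have := congr1 (fun c : chain K E => c (F1 :\ e)) dz.
    rewrite boundaryE ffunE (bigD1 e) ?setD11 //= setD1K // big1.
      move/eqP; rewrite addr0 mulf_eq0 (negbTE zF1) orbF signr_eq0 //.
    move=> f /andP[fF fe]; have := no f; rewrite fF fe /= => /negbFE /eqP ->.
    by rewrite mulr0.
  have fF1 : f \notin F1 by move: fF; rewrite !inE fe.
  set F2 := f |: F1 :\ e in zf.
  have [F2D0 _] := mem_chains _ _ _ zD0 _ zf.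
  have F2D : F2 \in faces D by apply: (subsetP D0_sub).
  have v12 : val F1 = val F2.
    apply/eqP; rewrite eqn_leq (maxF1 _ zf) andbT.
    have <- : val (F1 :\ e) = val F1.
      apply: (val_interval filt); last exact: subD1set.
      by rewrite subsetD1 es (sig_sub filt).
    by apply: (val_mono filt); apply: subsetU1.
  have [_ sU _] := fibre_union filt (D_small F1D) (D_small F2D) v12.
  have UD0 : F1 :|: F2 \in faces D0.
    by apply: D0_full; [apply: D_union | rewrite subUset !D0_C].
  have := D0_dim UD0; apply/negP; rewrite -ltnNge.
  apply: (@leq_trans #|f |: F1|); first by rewrite cardsU1 fF1 F1d.
  apply: subset_leq_card; rewrite subUset subsetUl andbT sub1set !inE eqxx.
  by rewrite orbT.
have [] := @reduce_value K E D val q.+2 (val F1).+1 w (val_mono filt) _ wD.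
- by move=> F FD nF; apply: fibre_toggle; rewrite ?nF -?qd.
- by move=> G; rewrite -zE ltnS; apply: maxF1.
move=> w' [w'D ww' w'm].
have zE' : z = boundary K E w'.
  apply/eqP; rewrite zE -subr_eq0 -linearB; case/memv_imgP: ww' => c _ -> /=.
  by rewrite boundary_boundary.
move: (zF1); rewrite zE' => /boundary_neq0[f [fF1 wf]].
have [fD fn] := mem_chains _ _ _ w'D _ wf.
have vf : val (f |: F1) = val F1.
  apply/eqP; rewrite eqn_leq -ltnS w'm //=.
  by apply: (val_mono filt); apply: subsetU1.
(* [f |: F1] lies in the fibre of [F1]: inside [C] it is too large for [D0], otherwise
   [fibre_single] excludes it. *)
have [fC | fC] := boolP (f \in C).
  have : f |: F1 \in faces D0.
    by apply: D0_full; rewrite ?subUset ?sub1set ?fC ?D0_C.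
  by move/D0_dim; rewrite fn qd ltnn.
have fE : f \in EG by apply: (subsetP (D_EG fD)); apply: setU11.
by have := fibre_single filt (D_small F1D) (D0_C F1D0) sF1 F1d fE fC; rewrite vf eqxx.
Qed.

End FilteredComplex.

(** * The divided power of a 2-form *)

Section DividedPower.
Variables (K : fieldType) (E : finType) (f : nat -> E).
Local Notation chain := (chain K E).
Implicit Types (c : chain) (I : seq nat).

Definition wedge_pair (i : nat) c : chain := wedge (f i) (wedge (f i.+1) c).
(** Multiplication by the boundary of the pair [f i ^ f i.+1]. *)
Definition wedge_diff (i : nat) c : chain := wedge (f i.+1) c - wedge (f i) c.

(* The coefficient of x ^ k in the product of the 1 + x (f i ^ f i.+1), i in I:
   the divided power of the 2-form sum_i f i ^ f i.+1. *)
Fixpoint divided_power I (k : nat) : chain :=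
  match I with
  | [::] => if k is 0 then simplex K set0 else 0
  | i :: I' => divided_power I' k +
      (if k is k'.+1 then wedge_pair i (divided_power I' k') else 0)
  end.

Lemma divided_power0 I : divided_power I 0 = simplex K set0.
Proof. by elim: I => //= i I ->; rewrite addr0. Qed.

Lemma boundary_set0 : boundary K E (simplex K set0) = 0.
Proof. by rewrite boundary_simplex big1 // => x; rewrite inE. Qed.

Lemma boundary_wedge_pair i c : boundary K E (wedge_pair i c) =
  wedge_diff i c + wedge_pair i (boundary K E c).
Proof.
by rewrite /wedge_pair /wedge_diff !boundary_wedge linearB opprB addrA addrAC.
Qed.

(** A pair has even degree, hence is central. *)
Lemma wedge_pair_wedge i e c :
  wedge_pair i (wedge e c) = wedge e (wedge_pair i c).
Proof.
rewrite /wedge_pair [wedge (f i.+1) (wedge e c)]wedge_anti linearN /=.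
by rewrite wedge_anti opprK.
Qed.

Lemma wedge_diff_pair i c : wedge_diff i (wedge_pair i c) = 0.
Proof.
rewrite /wedge_diff /wedge_pair wedge_wedge subr0.
by rewrite wedge_anti wedge_wedge linear0 oppr0.
Qed.

(** The chain rule for divided powers; the cross term vanishes because the boundary of a pair
    annihilates the pair. *)
Lemma boundary_divided_power I k : boundary K E (divided_power I k.+1) =
  \sum_(i <- I) wedge_diff i (divided_power I k).
Proof.
elim: I k => [|i I IH] k /=; first by rewrite big_nil linear0.
rewrite big_cons linearD /= IH boundary_wedge_pair.
have dl j c c' : wedge_diff j (c + c') = wedge_diff j c + wedge_diff j c'.
  by rewrite /wedge_diff !linearD addrACA.
have dls c c' : \sum_(j <- I) wedge_diff j (c + c') =
    \sum_(j <- I) wedge_diff j c + \sum_(j <- I) wedge_diff j c'.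
  by rewrite -big_split; apply: eq_bigr => j _; rewrite dl.
rewrite dl dls.
have dl0 j : wedge_diff j 0 = 0 by rewrite /wedge_diff !linear0 addr0.
case: k => [|k].
  rewrite divided_power0 boundary_set0 /wedge_pair !linear0 dl0 !addr0.
  by rewrite [X in _ = _ + (_ + X)]big1 ?addr0 => [|j _]; first exact: addrC.
rewrite wedge_diff_pair addr0 [RHS]addrCA; congr (_ + (_ + _)).
rewrite IH /wedge_pair !linear_sum; apply: eq_bigr => j _ /=.
by rewrite -/(wedge_pair i _) {1}/wedge_diff /wedge_pair !linearB /= -!/(wedge_pair i _) !wedge_pair_wedge.
Qed.

(** The factors [f i.+1 - f i] telescope around the closed sequence. *)
Lemma divided_power_closed l k : f l = f 0 ->
  boundary K E (divided_power (iota 0 l) k) = 0.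
Proof.
move=> fl; case: k => [|k]; first by rewrite divided_power0 boundary_set0.
rewrite boundary_divided_power -{1}[l]subn0 -/(index_iota 0 l).
rewrite /wedge_diff (telescope_sumr (fun i => wedge (f i) _)) //.
by rewrite fl subrr.
Qed.

Lemma divided_power_supp I k F : divided_power I k F != 0 ->
  #|F| = (2 * k)%N /\ exists J : seq nat,
  [/\ size J = k, {subset J <= I} &
   forall e, e \in F -> exists2 i, i \in J & e = f i \/ e = f i.+1].
Proof.
elim: I k F => [|i I IH] k F /=.
  case: k => [|k]; last by rewrite ffunE eqxx.
  rewrite ffunE; case: (F =P set0) => [-> _ | _]; last by rewrite eqxx.
  by rewrite cards0; split=> //; exists [::]; split=> // e; rewrite inE.
rewrite ffunE; have [-> | /IH[nF [J [sJ JI cJ]]] _] := eqVneq (divided_power I k F) 0; last first.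
  by split=> //; exists J; split=> // j /JI jI; rewrite inE jI orbT.
rewrite add0r; case: k => [|k]; first by rewrite ffunE eqxx.
case/wedge_neq0=> iF /wedge_neq0[i'F /IH[nF [J [sJ JI cJ]]]].
split; first by rewrite (cardsD1 (f i)) iF (cardsD1 (f i.+1)) i'F nF mulnS.
exists (i :: J); split=> [|j|e eF]; first by rewrite /= sJ.
  by rewrite !inE => /orP[-> // | /JI ->]; rewrite orbT.
have [-> | nei] := eqVneq e (f i); first by exists i; [rewrite mem_head | left].
have [-> | nei'] := eqVneq e (f i.+1); first by exists i; [rewrite mem_head | right].
have [|j jJ ej] := cJ e; first by rewrite !inE nei nei'.
by exists j; rewrite // inE jJ orbT.
Qed.

Lemma divided_power_supp_range a m k F e :
  divided_power (iota a m) k F != 0 -> e \in F ->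
  exists2 i, (a <= i <= a + m)%N & e = f i.
Proof.
case/divided_power_supp=> _ [J [_ JI cJ]] /cJ[i /JI].
rewrite mem_iota => /andP[ai im] [] ->.
  by exists i => //; rewrite ai ltnW.
by exists i.+1; rewrite // im leqW.
Qed.

Definition segment j k : {set E} := [set e in [seq f i | i <- iota j (2 * k)]].

(** A run of 2 k consecutive elements splits into consecutive pairs in only one way, so its
    coefficient is a sign. *)
Lemma divided_power_segment (a b j m k : nat) :
  {in [pred i | (a <= i <= b)%N] &, injective f} ->
  (a <= j)%N -> (j + m <= b)%N -> (2 * k <= m.+1)%N ->
  divided_power (iota j m) k (segment j k) != 0.
Proof.
move=> inj; elim: k j m => [|k IH] j m aj jmb km.
  rewrite divided_power0 ffunE; have -> : segment j 0 = set0 by apply/setP=> e; rewrite !inE.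
  by rewrite eqxx oner_eq0.
have out i n k' (F : {set E}) : (a <= i)%N -> (i.+1 + n <= b)%N -> f i \in F ->
    divided_power (iota i.+1 n) k' F = 0.
  move=> ai inb iF; apply/eqP; apply: contraT => /divided_power_supp_range /(_ iF).
  case=> i' /andP[ii' i'n] /inj eq; have h : i = i' by apply: eq; rewrite inE; lia.
  by rewrite h ltnn in ii'.
case: m jmb km => [|m] jmb km; first by lia.
have segS i k' : segment i k'.+1 = f i |: (f i.+1 |: segment i.+2 k').
  by apply/setP=> e; rewrite /segment mulnS !inE /= ?inE.
have segN i k' i' : (a <= i' < i)%N -> (i + 2 * k' <= b.+1)%N -> f i' \notin segment i k'.
  move=> ai ib; rewrite inE; apply/negP => /mapP[i''].
  rewrite mem_iota => /andP[ii ik] /inj eq; have : i' = i'' by apply: eq; rewrite inE; lia.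
  by move=> eq'; move: ii; rewrite -eq'; lia.
have ne : f j != f j.+1.
  apply/eqP => /inj eq; have : j = j.+1 by apply: eq; rewrite inE; lia.
  by lia.
(* Only the pair at [j] contains [f j], so the summand omitting it vanishes. *)
rewrite /= ffunE out ?add0r; try lia; last by rewrite segS setU11.
have N1 : f j \notin f j.+1 |: segment j.+2 k.
  by rewrite inE negb_or inE ne segN //; lia.
have N2 : f j.+1 \notin segment j.+2 k by rewrite segN //; lia.
rewrite /wedge_pair !ffunE segS setU11 setU1K // setU11 setU1K //.
rewrite !mulf_neq0 ?signr_eq0 //.
case: k IH km segS N1 N2 => [|k] IH km segS N1 N2.
  rewrite divided_power0 ffunE; have -> : segment j.+2 0 = set0 by apply/setP=> e; rewrite !inE.
  by rewrite eqxx oner_eq0.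
case: m jmb km => [|m] jmb km; first by lia.
(* [f j.+1] is used up, so the pair at [j.+1] contributes nothing. *)
rewrite /= ffunE /wedge_pair [X in _ + X]ffunE (negbTE N2) addr0.
by apply: IH; lia.
Qed.

End DividedPower.

(** * Non-matching complexes *)

Section Bipartite.
Variables (T : finType) (G : sgraph T) (A : {set T}) (x0 : T).
Hypothesis G_bip : forall e, e \in edges G -> #|e :&: A| = 1%N /\ #|e :\: A| = 1%N.

Definition left_end (e : {set T}) : T := odflt x0 [pick x in e :&: A].
Definition right_end (e : {set T}) : T := odflt x0 [pick x in e :\: A].

Lemma left_endE e : e \in edges G -> e :&: A = [set left_end e].
Proof.
move=> /G_bip[/eqP/cards1P[x eA] _]; rewrite /left_end eA.
by case: pickP => [y /[!inE] /eqP -> | /(_ x)] //; rewrite inE eqxx.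
Qed.

Lemma right_endE e : e \in edges G -> e :\: A = [set right_end e].
Proof.
move=> /G_bip[_ /eqP/cards1P[x eA]]; rewrite /right_end eA.
by case: pickP => [y /[!inE] /eqP -> | /(_ x)] //; rewrite inE eqxx.
Qed.

Lemma left_endP e x : e \in edges G -> x \in e -> x \in A -> x = left_end e.
Proof.
by move=> /left_endE eA xe xA; apply/set1P; rewrite -eA inE xe.
Qed.

Lemma right_endP e x : e \in edges G -> x \in e -> x \notin A -> x = right_end e.
Proof.
by move=> /right_endE eA xe xA; apply/set1P; rewrite -eA inE xe xA.
Qed.

Lemma left_end_in e : e \in edges G -> left_end e \in e /\ left_end e \in A.
Proof. by move=> /left_endE eA; apply/setIP; rewrite eA set11. Qed.

Lemma right_end_in e : e \in edges G -> right_end e \in e /\ right_end e \notin A.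
Proof. by move=> /right_endE eA; apply/setDP; rewrite eA set11. Qed.

Lemma bipartition_ends : bipartition A left_end right_end (edges G).
Proof.
split=> [e eG | e f eG fG l r].
  by have [_ ?] := left_end_in eG; have [_ ?] := right_end_in eG.
by rewrite -(setID e A) -(setID f A) !left_endE // !right_endE // l r.
Qed.

Lemma trivIset_ends (M : {set {set T}}) : M \subset edges G ->
  trivIset M <-> {in M &, injective left_end} /\ {in M &, injective right_end}.
Proof.
move=> /subsetP MG; split=> [/trivIsetP tM | [injA injB]].
  have disj e f x : e \in M -> f \in M -> x \in e -> x \in f -> e = f.
    move=> eM fM xe xf; apply/eqP; apply: contraT => ne.
    by have /pred0P /(_ x) := tM e f eM fM ne; rewrite /= xe xf.
  split=> e f eM fM eq.
    apply: (disj e f (left_end e)) => //; first by have [] := left_end_in (MG e eM).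
    by rewrite eq; have [] := left_end_in (MG f fM).
  apply: (disj e f (right_end e)) => //; first by have [] := right_end_in (MG e eM).
  by rewrite eq; have [] := right_end_in (MG f fM).
apply/trivIsetP=> e f eM fM; apply: contraNT => /pred0Pn[x /andP[/= xe xf]].
apply/eqP; have [xA | xA] := boolP (x \in A).
  by apply: injA => //; rewrite -(left_endP (MG e eM) xe xA) -(left_endP (MG f fM) xf xA).
by apply: injB => //; rewrite -(right_endP (MG e eM) xe xA) -(right_endP (MG f fM) xf xA).
Qed.

(** Smallness refers to the edges of [G], so the filtration of [G] serves every subgraph [H]. *)
Lemma NM_facesP (H : sgraph T) k (F : {set {set T}}) : edges H \subset edges G ->
  F \in faces (NM k.+1 H) <->
  F \subset edges H /\ few_disjoint left_end right_end (edges G) k F.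
Proof.
move=> HG; rewrite inE; split=> [/andP[FH nF] | [FH [FG mF]]].
  split=> //; split=> [|M MF injA injB]; first exact: subset_trans HG.
  rewrite -ltnS; apply: leq_ltn_trans nF; rewrite /matching_number.
  have MG : M \subset edges G by rewrite (subset_trans MF) // (subset_trans FH).
  apply: (leq_bigmax_cond (F := fun M : {set {set T}} => #|M|)).
  rewrite subsetI MF (subset_trans MF FH) /=.
  exact: (trivIset_ends MG).2.
rewrite FH ltnS; apply/bigmax_leqP=> M /andP[MF tM].
have {}MF : M \subset F by apply: subset_trans MF (subsetIl _ _).
by have [injA injB] := (trivIset_ends (subset_trans MF FG)).1 tM; apply: mF.
Qed.

End Bipartite.

Lemma NM_edges (T : finType) t (G H : sgraph T) : edges G = edges H ->
  NM t G = NM t H.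
Proof.
move=> GH; have fE : faces (NM t G) = faces (NM t H).
  apply/setP=> F; rewrite !inE /matching_number.
  by congr (_ && (_ < t)%N); rewrite /spanning /= GH.
case: (NM t G) (NM t H) fE (GH : vset (NM t G) = vset (NM t H)).
move=> v1 f1 p1 q1 [v2 f2 p2 q2] /= ef ev; case: _ / ef in p2 q2 *; case: _ / ev in p2 *.
by congr SComplex; apply: bool_irrelevance.
Qed.

(** * A nonzero homology cycle on a cycle graph *)

Section CycleGraph.
Variables (T : finType) (C : sgraph T) (s : seq T) (x0 : T).
Hypotheses (us : uniq s) (s3 : (3 <= size s)%N).
Hypothesis EC : edges C = [set [set x; next s x] | x in s].
Local Notation l := (size s).

(** Indices are read modulo the length, so that the sequence of edges closes up. *)
Definition cyc_vertex (i : nat) : T := nth x0 s (i %% l).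
Definition cyc_edge (i : nat) : {set T} := [set cyc_vertex i; cyc_vertex i.+1].

Lemma cyc_vertex_inj i j : (cyc_vertex i == cyc_vertex j) = (i == j %[mod l]).
Proof. by rewrite nth_uniq // ltn_pmod // (leq_trans _ s3). Qed.

Lemma next_cyc_vertex i : next s (cyc_vertex i) = cyc_vertex i.+1.
Proof.
have il : (i %% l < l)%N by rewrite ltn_pmod // (leq_trans _ s3).
rewrite next_nth mem_nth // /cyc_vertex index_uniq // -addn1 -modnDml addn1.
case: s il => // x s' il; move: (i %% _)%N il => j /=.
rewrite ltnS leq_eqVlt => /orP[/eqP -> | js].
  by rewrite modnn nth_default.
by rewrite modn_small // (set_nth_default x0).
Qed.

Lemma cyc_edge_in i : cyc_edge i \in edges C.
Proof.
rewrite EC; apply/imsetP; exists (cyc_vertex i); last by rewrite next_cyc_vertex.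
by rewrite mem_nth // ltn_pmod // (leq_trans _ s3).
Qed.

Lemma cyc_edge_period : cyc_edge l = cyc_edge 0.
Proof. by rewrite /cyc_edge /cyc_vertex -addn1 modnn mod0n modnDl. Qed.

(** For length at least 3 an edge determines its two consecutive residues. The window starts at 1,
    where the segment of [NM_cycle_nonzero] starts. *)
Lemma cyc_edge_inj : {in [pred i | (1 <= i <= l)%N] &, injective cyc_edge}.
Proof.
move=> i j; rewrite !inE => il jl eq.
have : cyc_vertex i \in cyc_edge j by rewrite -eq !inE eqxx.
have : cyc_vertex i.+1 \in cyc_edge j by rewrite -eq !inE eqxx orbT.
rewrite !inE !cyc_vertex_inj => h2 h1.
have mE n : (1 <= n <= l)%N -> (n %% l)%N = (if n == l then 0 else n)%N.
  by move=> nl; case: (n =P l) => [-> | ne]; [rewrite modnn | rewrite modn_small; lia].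
have mS n : (1 <= n <= l)%N -> (n.+1 %% l)%N = (if n == l then 1 else if n.+1 == l then 0 else n.+1)%N.
  move=> nl; case: (n =P l) => [-> | ne].
    by rewrite -addn1 modnDl modn_small //; lia.
  by case: (n.+1 =P l) => [-> | ne']; [rewrite modnn | rewrite modn_small; lia].
move: h1 h2; rewrite (mE i il) (mE j jl) (mS i il) (mS j jl).
by do !case: eqP; lia.
Qed.

Lemma NM_cycle_nonzero (K : fieldType) k : (2 * k.+1 <= l)%N -> (0 < k)%N ->
  exists z, [/\ z \in cycles K (NM k.+1 C) (2 * k).-1 & z != 0].
Proof.
move=> kl k0; exists (divided_power K cyc_edge (iota 0 l) k); split.
  have kk : (2 * k).-1.+1 = (2 * k)%N by rewrite prednK // muln_gt0.
  rewrite memv_cap memv_ker divided_power_closed ?eqxx ?andbT; last exact: cyc_edge_period.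
  rewrite kk; apply/mem_chains => F /divided_power_supp[nF [J [sJ JI cJ]]].
  split=> //; rewrite inE; apply/andP; split.
    by apply/subsetP=> e /cJ[i _] [] ->; apply: cyc_edge_in.
  rewrite ltnS; apply/bigmax_leqP=> M /andP[MF /trivIsetP tM].
  have {}MF : {subset M <= F} by move=> e /(subsetP MF); rewrite inE => /andP[].
  (* The two edges of a pair share the vertex [i.+1], so k vertices meet every edge of [F] and
     disjoint edges choose distinct ones. *)
  pose S := [set x in [seq cyc_vertex i.+1 | i <- J]].
  have meet e : e \in M -> exists x, x \in e :&: S.
    move=> /MF /cJ[i iJ ee]; exists (cyc_vertex i.+1).
    apply/setIP; split; first by case: ee => ->; rewrite !inE eqxx ?orbT.
    by rewrite inE (map_f (fun i => cyc_vertex i.+1)).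
  pose g e := odflt x0 [pick x in e :&: S].
  have gP e : e \in M -> g e \in e :&: S.
    by move=> /meet[x xe]; rewrite /g; case: pickP => [y //| /(_ x)]; rewrite xe.
  have gi : {in M &, injective g}.
    move=> e f eM fM eq; apply/eqP; apply: contraT => ne.
    have /pred0P /(_ (g e)) := tM e f eM fM ne.
    have := gP e eM; have := gP f fM; rewrite -eq !inE /= => /andP[-> _] /andP[-> _] //.
  rewrite -(card_in_imset gi) (@leq_trans #|S|) //.
    apply: subset_leq_card; apply/subsetP=> _ /imsetP[e eM ->].
    by have := gP e eM; rewrite inE => /andP[].
  by rewrite cardsE (leq_trans (card_size _)) // size_map sJ.
apply/eqP => /(congr1 (fun c : chain K _ => c (segment cyc_edge 1 k))).
rewrite [RHS]ffunE; apply/eqP.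
have := @divided_power_segment K _ cyc_edge 1 l 1 l.-1 k cyc_edge_inj.
have [l' El] : exists l', l = l'.+1 by exists l.-1; lia.
rewrite El /= => h; rewrite ffunE.
(* Edge 0 equals edge l, which lies outside the segment 1, ..., 2 k, so the pair at 0 contributes
   nothing. *)
have -> : (if k is k'.+1 then wedge_pair cyc_edge 0 (divided_power K cyc_edge (iota 1 l') k') else 0)
    (segment cyc_edge 1 k) = 0.
  case: k kl k0 h => // k' kl _ _; rewrite ffunE ifN // inE.
  apply/negP => /mapP[i]; rewrite mem_iota => /andP[i1 ik].
  rewrite -cyc_edge_period => /cyc_edge_inj eq.
  have li : l = i by apply: eq; rewrite inE; lia.
  lia.
by rewrite addr0; apply: h; lia.
Qed.

End CycleGraph.

(** * Leray numbers of bipartite graphs containing a long cycle *)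

Section BipartiteCycle.
Variables (K : fieldType) (T : finType) (G C : sgraph T) (A : {set T}).
Hypothesis G_bip : forall e, e \in edges G -> #|e :&: A| = 1%N /\ #|e :\: A| = 1%N.
Variables (s : seq T) (x0 : T) (k : nat).
Hypotheses (us : uniq s) (s3 : (3 <= size s)%N).
Hypothesis EC : edges C = [set [set x; next s x] | x in s].
Hypothesis CG : edges C \subset edges G.
Hypotheses (k0 : (0 < k)%N) (kl : (2 * k.+1 <= size s)%N).

Local Notation left_end := (left_end A x0).
Local Notation right_end := (right_end A x0).

Lemma ends_set2 x y : [set x; y] \in edges G ->
  if x \in A then left_end [set x; y] = x /\ right_end [set x; y] = y
  else left_end [set x; y] = y /\ right_end [set x; y] = x.
Proof.
move=> eG; have [lin lA] := left_end_in x0 G_bip eG.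
have [rin rA] := right_end_in x0 G_bip eG.
case: ifP => xA.
  split; first by apply/esym/(left_endP x0 G_bip eG); rewrite // !inE eqxx.
  by move: rin; rewrite !inE => /orP[] /eqP h //; rewrite h xA in rA.
split; last by apply/esym/(right_endP x0 G_bip eG); rewrite ?xA // !inE eqxx.
by move: lin; rewrite !inE => /orP[] /eqP h //; rewrite h xA in lA.
Qed.

(* The edges of a cycle oriented from A form a matching, and so do the others. *)
Lemma cycle_face_card F : F \in faces (NM k.+1 C) -> (#|F| <= 2 * k)%N.
Proof.
move=> /(NM_facesP x0 G_bip _ _ CG)[FC [FG mF]].
pose P := [set e : {set T} | [exists x, [&& x \in s, x \in A & e == [set x; next s x]]]].
have next_inj : injective (next s) := can_inj (prev_next us).
have outP e : e \in F :\: P -> exists x,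
    [/\ [set x; next s x] \in edges G, x \notin A & e = [set x; next s x]].
  case/setDP=> eF; have := subsetP FC e eF; rewrite EC => /imsetP[x xs eE] eP.
  exists x; split=> //; first by rewrite -eE; apply: (subsetP FG).
  by apply: contra eP => xA; rewrite inE; apply/existsP; exists x; rewrite xs xA eE eqxx.
rewrite -(cardsID P F) mul2n -addnn; apply: leq_add; apply: mF.
- exact: subsetIl.
- move=> e f /setIP[eF]; rewrite inE => /existsP[x /and3P[_ xA /eqP eE]].
  case/setIP=> fF; rewrite inE => /existsP[x' /and3P[_ x'A /eqP fE]].
  have := subsetP FG e eF; have := subsetP FG f fF; rewrite eE fE => /ends_set2 + /ends_set2.
  by rewrite xA x'A => -[-> _] [-> _] ->.
- move=> e f /setIP[eF]; rewrite inE => /existsP[x /and3P[_ xA /eqP eE]].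
  case/setIP=> fF; rewrite inE => /existsP[x' /and3P[_ x'A /eqP fE]].
  have := subsetP FG e eF; have := subsetP FG f fF; rewrite eE fE => /ends_set2 + /ends_set2.
  by rewrite xA x'A => -[_ ->] [_ ->] /next_inj ->.
- exact: subsetDl.
- move=> e f /outP[x [eG xA ->]] /outP[x' [fG x'A ->]].
  have := ends_set2 eG; have := ends_set2 fG; rewrite (negbTE xA) (negbTE x'A).
  by move=> [-> _] [-> _] /next_inj ->.
- move=> e f /outP[x [eG xA ->]] /outP[x' [fG x'A ->]].
  have := ends_set2 eG; have := ends_set2 fG; rewrite (negbTE xA) (negbTE x'A).
  by move=> [_ ->] [_ ->] ->.
Qed.

(** An induced subcomplex consists of all small sets inside [W] and [edges H]; it is closed under
    small unions, so [filtered_acyclic] applies. *)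
Lemma NM_leray_bound (H : sgraph T) : edges H \subset edges G ->
  leray_bound K (NM k.+1 H) (2 * k).
Proof.
move=> HG W WH q kq; apply: homology_eq0.
have EGP := bipartition_ends x0 G_bip.
have [val [sig filt]] := exists_filtration EGP set0 k.
have facesP F : F \in faces (induced (NM k.+1 H) W) <->
    [/\ F \subset edges H, F \subset W & few_disjoint left_end right_end (edges G) k F].
  rewrite inE; split.
    by case/andP=> /(NM_facesP x0 G_bip _ _ HG)[].
  by case=> FH -> fF; rewrite andbT; apply/(NM_facesP x0 G_bip _ _ HG).
apply: (filtered_acyclic K filt) => // [F /facesP[] // | F F' /facesP[FH FW _]].
by case/facesP=> F'H F'W _ fU; apply/facesP; rewrite !subUset FH F'H FW.
Qed.

(* D stands for NM H or one of its induced subcomplexes. *)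
Lemma NM_cycle_not_bounding (D : scomplex {set T}) (Q : {set {set T}}) z :
  (forall F, F \in faces D <->
     F \subset Q /\ few_disjoint left_end right_end (edges G) k F) ->
  edges C \subset Q ->
  z \in cycles K (NM k.+1 C) (2 * k).-1 -> z \in boundaries K D (2 * k).-1 ->
  z = 0.
Proof.
move=> facesP CQ; have EGP := bipartition_ends x0 G_bip.
have [val [sig filt]] := exists_filtration EGP (edges C) k.
apply: (cycle_not_bounding filt).
- by move=> F /facesP[].
- by move=> F F' /facesP[FQ _] /facesP[F'Q _] fU; apply/facesP; rewrite subUset FQ.
- by move=> F /facesP[_ []].
- apply/subsetP=> F /(NM_facesP x0 G_bip _ _ CG)[FC fF]; apply/facesP.
  by split=> //; apply: subset_trans CQ.
- by move=> F /(NM_facesP x0 G_bip _ _ CG)[].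
- by move=> F /facesP[_ fF] FC; apply/(NM_facesP x0 G_bip _ _ CG).
- exact: cycle_face_card.
- by rewrite prednK // muln_gt0.
Qed.

Lemma NM_homology_neq0 (D : scomplex {set T}) (Q : {set {set T}}) :
  (forall F, F \in faces D <->
     F \subset Q /\ few_disjoint left_end right_end (edges G) k F) ->
  edges C \subset Q -> exists h : homology K D (2 * k).-1, h != 0.
Proof.
move=> facesP CQ; have [z [zc zn0]] := NM_cycle_nonzero x0 us s3 EC K kl k0.
have sub : faces (NM k.+1 C) \subset faces D.
  apply/subsetP=> F /(NM_facesP x0 G_bip _ _ CG)[FC fF]; apply/facesP.
  by split=> //; apply: subset_trans CQ.
apply: (homology_neq0 (z := z)); first exact: (subvP (cycles_sub K _ sub)).
by apply: contra zn0 => zb; apply/eqP/(NM_cycle_not_bounding facesP).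
Qed.

Lemma NM_leray_number (H : sgraph T) : edges H \subset edges G ->
  edges C \subset edges H -> leray_number_is K (NM k.+1 H) (2 * k).
Proof.
move=> HG CH; split=> [|d' bd]; first exact: NM_leray_bound.
rewrite leqNgt; apply/negP => lt.
(* Inducing on all of [edges H] keeps every face and gives a nonzero class in degree 2 k - 1, where
   a bound below 2 k demands vanishing. *)
have [|h /eqP[]] := @NM_homology_neq0 (induced (NM k.+1 H) (edges H)) (edges H) _ CH.
  move=> F; rewrite inE; split=> [/andP[/(NM_facesP x0 G_bip _ _ HG) // ]|[FH fF]].
  by rewrite FH andbT; apply/(NM_facesP x0 G_bip _ _ HG).
apply: (bd (edges H)); first exact: subxx.
by rewrite -ltnS prednK // muln_gt0.
Qed.

Lemma NM_cycle_injective (H : sgraph T) : edges H \subset edges G ->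
  edges C \subset edges H ->
  exists sub : faces (NM k.+1 C) \subset faces (NM k.+1 H),
    injective (homology_map K (2 * k).-1 sub).
Proof.
move=> HG CH; have facesP F := NM_facesP x0 G_bip k F HG.
have sub : faces (NM k.+1 C) \subset faces (NM k.+1 H).
  apply/subsetP=> F /(NM_facesP x0 G_bip _ _ CG)[FC fF]; apply/facesP.
  by split=> //; apply: subset_trans CH.
exists sub; apply: homology_map_inj => z zc zb.
by rewrite (NM_cycle_not_bounding facesP CH zc zb) rpred0.
Qed.

End BipartiteCycle.

Theorem theorem2p3 (K : fieldType) (T : finType) (G C : sgraph T) (t l : nat)
  (t_ge2 : (2 <= t)%N) (G_bip : bipartite G)
  (C_cycle : is_cycle C l) (C_sub : subgraph C G) (l_ge : (2 * t <= l)%N) :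
  NM t C = NM t (spanning G (edges C)) /\
  (forall W : {set {set T}}, W \subset edges G -> edges C \subset W ->
     (exists sub : faces (NM t C) \subset faces (NM t (spanning G W)),
        injective (homology_map K (2 * t - 3)%N sub)) /\
     (exists h : homology K (NM t (spanning G W)) (2 * t - 3)%N, h != 0) /\
     leray_number_is K (NM t (spanning G W)) (2 * t - 2)%N) /\
  leray_number_is K (NM t G) (2 * t - 2)%N.
Proof.
case: G_bip => A [_ GA]; case: C_cycle => s [us sl l3 _ EC].
case/andP: C_sub => _ CG.
have s3 : (3 <= size s)%N by rewrite sl.
have [x0 _] : exists x, x \in s.
  by case: s s3 {us sl EC} => // x s' _; exists x; rewrite mem_head.
(* With t = k + 1, the degree 2 t - 3 is 2 k - 1 and the Leray number 2 t - 2 is 2 k. *)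
case: t t_ge2 l_ge => // k; rewrite ltnS => k0 kl.
have kl' : (2 * k.+1 <= size s)%N by rewrite sl.
have -> : (2 * k.+1 - 3 = (2 * k).-1)%N by lia.
have -> : (2 * k.+1 - 2 = 2 * k)%N by lia.
split; first by apply: NM_edges; apply/esym/setIidPl.
split=> [W WG CW|]; last exact: (NM_leray_number K GA x0 us s3 EC CG k0 kl').
have WE : edges (spanning G W) = W by apply/setIidPl.
have HG : edges (spanning G W) \subset edges G by rewrite WE.
have CH : edges C \subset edges (spanning G W) by rewrite WE.
split; first exact: (NM_cycle_injective K GA x0 us EC CG k0 HG CH).
split; last exact: (NM_leray_number K GA x0 us s3 EC CG k0 kl').
exact: (NM_homology_neq0 K GA us s3 EC CG k0 kl' (fun F => NM_facesP x0 GA k F HG) CH).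
Qed.
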